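(* There is a constant $C>0$, independent of $\varepsilon$, $N$, $i$, $j$, $w$ and $v^N$, such that the following holds. Let $w\in C^3(\bar\Omega)$, let $w^I$ be the standard nodal (continuous piecewise) linear interpolant of $w$ on the Shishkin triangulation $\mathcal{T}_N$, and let $v^N\in V^N$. Then, for every $\mathcal{Q}_{i,j}=K^2_{i,j-1}\cup K^1_{i,j}$ with $h_{y,j-1}=h_{y,j}$, $$\left\vert \int_{\mathcal{Q}_{i,j}} (w-w^{I})_{x}\,v^{N}_{x}\,dx\,dy\right\vert \le C\sum_{l+m=2}h^{l}_{x,i}h^{m}_{y,j} \left\Vert \frac{\partial^{3} w}{\partial x^{l+1}\partial y^m} \right\Vert_{L^{\infty}(\mathcal{Q}_{i,j})} \Vert v^{N}_{x} \Vert_{L^{1}(\mathcal{Q}_{i,j})},$$ and, for every $\mathcal{S}_{i,j}=K^2_{i-1,j}\cup K^1_{i,j}$ with $h_{x,i-1}=h_{x,i}$, $$\left\vert \int_{\mathcal{S}_{i,j}} (w-w^{I})_{y}\,v^{N}_{y}\,dx\,dy\right\vert \le C\sum_{l+m=2}h^{l}_{x,i}h^{m}_{y,j} \left\Vert \frac{\partial^{3} w}{\partial x^{l}\partial y^{m+1}} \right\Vert_{L^{\infty}(\mathcal{S}_{i,j})} \Vert v^{N}_{y} \Vert_{L^{1}(\mathcal{S}_{i,j})},$$ where $l$ and $m$ range over nonnegative integers.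
   Context: $\Omega=(0,1)^2$. Parameters: $0<\varepsilon\le N^{-1}$, $N\ge 4$ an even integer, $\beta_1,\beta_2>0$ constants, $\rho=2.5$, $\lambda_x=\rho\varepsilon\beta_1^{-1}\ln N\le 1/2$, $\lambda_y=\rho\varepsilon\beta_2^{-1}\ln N\le 1/2$. Shishkin mesh: the points $0=x_0<x_1<\dots<x_N=1$ divide each of $[0,1-\lambda_x]$ and $[1-\lambda_x,1]$ into $N/2$ equal intervals; the points $0=y_0<\dots<y_N=1$ divide each of $[0,1-\lambda_y]$ and $[1-\lambda_y,1]$ into $N/2$ equal intervals. Put $h_{x,i}=x_{i+1}-x_i$, $h_{y,j}=y_{j+1}-y_j$ for $0\le i,j\le N-1$. Each rectangle $[x_i,x_{i+1}]\times[y_j,y_{j+1}]$ is divided into two triangles: $K^1_{i,j}$ with vertices $(x_i,y_j),(x_{i+1},y_j),(x_i,y_{j+1})$, and $K^2_{i,j}$ with vertices $(x_i,y_{j+1}),(x_{i+1},y_j),(x_{i+1},y_{j+1})$. The set of all these triangles is the triangulation $\mathcal{T}_N$. $V^N\subset H^1_0(\Omega)$ is the space of continuous functions that are linear on each triangle of $\mathcal{T}_N$ and vanish on $\partial\Omega$. In $\mathcal{Q}_{i,j}$ the indices satisfy $0\le i\le N-1$, $1\le j\le N-1$; in $\mathcal{S}_{i,j}$ they satisfy $1\le i\le N-1$, $0\le j\le N-1$. Subscripts $x$ and $y$ on functions denote partial derivatives (taken elementwise for piecewise polynomials). *)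

(* Defs.v *)
From HB Require Import structures.
From mathcomp Require Import all_boot all_order all_algebra.
From mathcomp Require Import all_classical all_reals all_analysis.

Set Implicit Arguments.
Unset Strict Implicit.
Unset Printing Implicit Defensive.

Import Order.TTheory GRing.Theory Num.Theory.
Import numFieldNormedType.Exports.

Local Open Scope classical_set_scope.
Local Open Scope ring_scope.

Section Domain.
Context {R : realType}.
Implicit Types (f : R * R -> R) (p : R * R).

Definition Omega : set (R * R) := `]0, 1[ `*` `]0, 1[.

Definition Omega_bar : set (R * R) := `[0, 1] `*` `[0, 1].

Definition bd_Omega : set (R * R) := Omega_bar `\` Omega.

Definition dx f : R * R -> R := fun p => 'D_((1, 0) : R * R) f p.

Definition dy f : R * R -> R := fun p => 'D_((0, 1) : R * R) f p.

(* [C_Omega_bar k f]: on [Omega] every partial derivative of [f] of order at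
   most [k] (in any order of differentiation) exists and has a continuous
   extension to the closed square.  Only the values of [f] on the open set
   [Omega] matter here. *)
Fixpoint C_Omega_bar (k : nat) f : Prop :=
  (exists2 g : R * R -> R, {within Omega_bar, continuous g}
                         & {in Omega, f =1 g})
  /\ (if k is k'.+1 then
        [/\ forall p, Omega p -> derivable f p ((1, 0) : R * R)
                              /\ derivable f p ((0, 1) : R * R),
            C_Omega_bar k' (dx f) & C_Omega_bar k' (dy f)]
      else True).

(* A function on the closed square is represented by a total function on the
   plane; its values outside [Omega_bar] are irrelevant. *)
Definition is_C3 f : Prop :=
  {within Omega_bar, continuous f} /\ C_Omega_bar 3 f.

(* The derivative of order [l] in x and [m] in y, set to 0 off [Omega]
   (the boundary of [Omega] is a null set). *)
Definition dxy (l m : nat) f : R * R -> R :=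
  (iter l dx (iter m dy f)) \_ Omega.

Definition area := (@lebesgue_measure R \x @lebesgue_measure R)%E.

Definition norm_Linfty (D : set (R * R)) f : \bar R :=
  'N[area]_+oo [(EFin \o (f \_ D))].

Definition norm_L1 (D : set (R * R)) f : \bar R :=
  'N[area]_1 [(EFin \o (f \_ D))].

End Domain.

Section Mesh.
Context {R : realType}.

Definition layer_width (eps beta : R) (N : nat) : R :=
  (5 / 2) * eps * beta^-1 * ln N%:R.

Definition shishkin (lambda : R) (N i : nat) : R :=
  if (i <= N./2)%N then i%:R * ((1 - lambda) / N./2%:R)
  else (1 - lambda) + (i - N./2)%:R * (lambda / N./2%:R).

Definition step (x : nat -> R) (i : nat) : R := x i.+1 - x i.

Definition triangle (a b c : R * R) : set (R * R) :=
  [set p | exists r s t : R,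
     [/\ 0 <= r, 0 <= s, 0 <= t & r + s + t = 1]
     /\ p = (r * a.1 + s * b.1 + t * c.1, r * a.2 + s * b.2 + t * c.2)].

Variables (x y : nat -> R) (N : nat).
Implicit Types (i j : nat) (f : R * R -> R).

Definition K1 i j := triangle (x i, y j) (x i.+1, y j) (x i, y j.+1).

Definition K2 i j := triangle (x i, y j.+1) (x i.+1, y j) (x i.+1, y j.+1).

Definition triangulation : set (set (R * R)) :=
  [set K | exists i j, [/\ (i < N)%N, (j < N)%N & K = K1 i j \/ K = K2 i j]].

(* Meaningful for 0 < j. *)
Definition Qset i j := K2 i j.-1 `|` K1 i j.

(* Meaningful for 0 < i. *)
Definition Sset i j := K2 i.-1 j `|` K1 i j.

Definition pw_linear f : Prop :=
  {within Omega_bar, continuous f} /\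
  forall K, triangulation K ->
    exists a b c : R, forall p, K p -> f p = a + b * p.1 + c * p.2.

Definition VN f : Prop := pw_linear f /\ forall p, bd_Omega p -> f p = 0.

Definition nodal_interpolant (w wI : R * R -> R) : Prop :=
  pw_linear wI /\
  forall i j, (i <= N)%N -> (j <= N)%N -> wI (x i, y j) = w (x i, y j).

Definition mesh_interior : set (R * R) :=
  \bigcup_(K in triangulation) K°.

(* Elementwise partial derivatives, set to 0 on the mesh lines (a null set). *)
Definition elt_dx f : R * R -> R := dx f \_ mesh_interior.

Definition elt_dy f : R * R -> R := dy f \_ mesh_interior.

End Mesh.

(* Main.v *)
Require Import Defs.
From HB Require Import structures.
From mathcomp Require Import all_boot all_order all_algebra.
From mathcomp Require Import all_classical all_reals all_analysis.
From mathcomp Require Import measurable_realfun ess_sup_inf ring lra.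

Import Order.TTheory GRing.Theory Num.Theory.
Import numFieldNormedType.Exports.

Local Open Scope classical_set_scope.
Local Open Scope ring_scope.

(** Let [Q] be one of the two-triangle cells [Qset x y i j] and write
[h = step x i], [k = step y j], [f = dx w]. The two triangles of [Q] share the
horizontal edge from [p = (x i, y j)] to [q = (x i.+1, y j)], and the
x-derivative of a function that is linear on a triangle is its slope along any
horizontal edge. So on almost all of [Q] the derivative of [vN] is one
constant [V], and that of the interpolant [wI] is the slope
[W = (w q - w p) / h] of [w] itself. The integral is therefore [V] times the
integral of [f - W] over [Q], while the L1 norm of the derivative of [vN] is
[`|V|] times the area of [Q]. It suffices to bound the mean of [f - W] over
[Q] by [M = h ^+ 2 * N30 + h * k * N21 + k ^+ 2 * N12], where [Nlm] is the
norm of [dxy l m w].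

Because [step y j.-1 = k], the set [Q] is a parallelogram, hence symmetric
about the midpoint [c] of the common edge. The reflection in [c] preserves
area, so the mean of [f - W] over [Q] is also the mean of
[(f z + f (2 c - z)) / 2 - W]. In absolute value this function is at most [M]:
the symmetrization cancels the first-order terms of [f] at [c], and [W], a
central difference quotient, agrees with [f c] up to second order. This is
[central_average]; the reflection argument is [integral_symmetric_bound], and
[glued_cell_bound] puts them together for an arbitrary direction of
differentiation. The resulting constant is [1].

In [central_average] the path from [c] to a point of [Q] first follows the
common edge and then goes in the vertical direction. It never leaves [Q],
which is why only the norms over [Q] occur, and along it the one-variable mean
value theorem applies directly to the partial derivatives. The mixed
derivatives that arise this way come in another order than those of [dxy];
they agree by [dx_dyC]. Finally the essential suprema bound the continuous
third derivatives at every point of the open parallelogram ([norm_Linfty_ge]).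

The cells [Sset x y i j] are the same figure with the coordinates
exchanged. *)

(** * Mean value estimates on the line *)

Section MeanValue.
Context {R : realType}.

(** The end points come in no particular order, because the estimates below
    start at the centre of symmetry and go both ways. *)
Lemma MVT_between (g dg : R -> R) (a b : R) :
  (forall x, Num.min a b <= x <= Num.max a b -> is_derive x 1 g (dg x)) ->
  exists2 c, Num.min a b <= c <= Num.max a b & g b - g a = dg c * (b - a).
Proof.
wlog ab : a b / a <= b => [hw Hd|].
  have /orP[ab|ba] := le_total a b; first exact: hw ab Hd.
  have [|c cab E] := hw _ _ ba.
    by move=> x hx; apply: Hd; rewrite minC maxC.
  exists c; first by rewrite minC maxC.
  by rewrite -opprB E -mulrN opprB.
rewrite min_l // max_r // => Hd.
have [] := @MVT_segment _ g dg a b ab.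
- move=> x; rewrite in_itv /= => /andP[/ltW ax /ltW xb].
  by apply: Hd; rewrite ax.
- apply: derivable_within_continuous => x; rewrite in_itv /= => xab.
  by have [] := Hd _ xab.
- by move=> c; rewrite in_itv /= => cab E; exists c.
Qed.

Lemma dist_le_deriv (g dg : R -> R) (a b M : R) :
  (forall x, Num.min a b <= x <= Num.max a b -> is_derive x 1 g (dg x)) ->
  (forall x, Num.min a b <= x <= Num.max a b -> `|dg x| <= M) ->
  `|g b - g a| <= M * `|b - a|.
Proof.
move=> Hd HM; have [c cab ->] := MVT_between _ _ _ _ Hd.
by rewrite normrM ler_wpM2r // HM.
Qed.

(** Two mean value steps: the increments of [g] on the two sides of [c] have
    opposite signs, so only the increment of [dg] between the two intermediate
    points survives. *)
Lemma second_difference_le (g dg ddg : R -> R) (c A M : R) :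
  (forall x, `|x - c| < A -> is_derive x 1 g (dg x)) ->
  (forall x, `|x - c| < A -> is_derive x 1 dg (ddg x)) ->
  (forall x, `|x - c| < A -> `|ddg x| <= M) ->
  forall a, `|a| < A -> `|g (c + a) + g (c - a) - 2 * g c| <= 2 * M * a ^+ 2.
Proof.
move=> H1 H2 HM a aA.
have [x|x xr E1] := MVT_between g dg c (c + a).
  by move=> xr; apply: H1; move: xr aA; rewrite !ltr_norml;
    case: (leP c (c+a)) => ? ? ?; lra.
have [y|y yr E2] := MVT_between g dg c (c - a).
  by move=> yr; apply: H1; move: yr aA; rewrite !ltr_norml;
    case: (leP c (c-a)) => ? ? ?; lra.
have -> : g (c + a) + g (c - a) - 2 * g c = a * (dg x - dg y).
  transitivity ((g (c + a) - g c) + (g (c - a) - g c)); first by ring.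
  by rewrite E1 E2; ring.
have inA z : Num.min y x <= z <= Num.max y x -> `|z - c| < A.
  move: xr yr aA; rewrite !ltr_norml.
  by case: (leP c (c+a)); case: (leP c (c-a));
    case: (leP y x) => ? ? ? ? ? ? ?; lra.
have := dist_le_deriv dg ddg y x M (fun z hz => H2 z (inA z hz)) (fun z hz =>
  HM z (inA z hz)).
have M0 : 0 <= M by apply: le_trans (HM c _); rewrite // subrr normr0;
  apply: le_lt_trans aA.
have xy : `|x - y| <= 2 * `|a|.
  move: xr yr; rewrite ler_norml.
  have [a0|a0] := leP 0 a; [rewrite ger0_norm//|rewrite ltr0_norm//];
    by case: (leP c (c+a)); case: (leP c (c-a)) => ? ? ? ?; lra.
rewrite normrM => h; rewrite -[a ^+ 2](real_normK (num_real a)).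
have := ler_wpM2l M0 xy; have := normr_ge0 a; nra.
Qed.

End MeanValue.

(** * The pointwise estimate on a parallelogram *)

Section Parallelogram.
Context {R : realType}.
Implicit Types (c d h k s t M : R).

(** The open parallelogram centred at [(c, d)] with vertical sides of length
    [k] on the lines [s = c - h / 2] and [s = c + h / 2]; its other two sides
    have slope [- k / h]. *)
Definition para c d h k s t : Prop :=
  `|s - c| < h / 2 /\ `|t - d + k / h * (s - c)| < k / 2.

Lemma para_sym c d h k s t : para c d h k s t ->
  para c d h k (2 * c - s) (2 * d - t).
Proof.
case=> H1 H2; split; rewrite -normrN.
  by have -> : - (2 * c - s - c) = s - c by ring.
by have -> : - (2 * d - t - d + k / h * (2 * c - s - c)) =
  t - d + k / h * (s - c) by ring.
Qed.

Lemma para_axis c d h k s : 0 < h -> 0 < k -> `|s - c| < h / 2 ->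
  `|k / h * (s - c)| < k / 2.
Proof.
move=> h0 k0 H; rewrite normrM gtr0_norm ?divr_gt0 //.
by rewrite -mulrA ltr_pM2l // mulrC ltr_pdivrMr // mulrC.
Qed.

(** Vertical sections of the parallelogram are intervals that meet the
    horizontal axis of symmetry, so the path along the axis and then straight
    up or down stays inside. *)
Lemma para_vert c d h k s t t' : 0 < h -> 0 < k -> para c d h k s t ->
  Num.min d t <= t' <= Num.max d t -> para c d h k s t'.
Proof.
move=> h0 k0 [H1 H2] ht; split => //.
have := para_axis c d h k s h0 k0 H1.
move: H2 ht; set z := k / h * _; rewrite !ltr_norml.
by case: (leP d t) => ? ? ? ?; lra.
Qed.

Lemma para_mid c d h k s : 0 < h -> 0 < k -> `|s - c| < h / 2 ->
  para c d h k s d.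
Proof. by move=> h0 k0 H; split=> //; rewrite subrr add0r;
  apply: para_axis. Qed.

Lemma para_height c d h k s t : 0 < h -> 0 < k -> para c d h k s t ->
  `|t - d| < k.
Proof.
move=> h0 k0 [H1 H2]; have := para_axis c d h k s h0 k0 H1.
by move: H2; set z := k / h * _; rewrite !ltr_norml => ? ?; lra.
Qed.

(** Write [W] for the difference quotient of [u] over the axis, whose length
    is [h]. Split [f s t + f (2 * c - s) (2 * d - t) - 2 * W] into the second
    difference of [f] along the axis, the error [2 * (f c d - W)], and the sum
    of the two vertical increments. The vertical increments go in opposite
    directions, so by the mean value theorem their sum is [t - d] times an
    increment of [fy]; that increment is again taken along the axis and two
    vertical segments. The function [u] is only assumed continuous up to the
    ends of the axis, since these may lie on the boundary of the square. *)
Lemma central_average (u f fx fy fxx fxy fyy : R -> R -> R)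
    c d h k (M1 M2 M3 : R) :
  0 < h -> 0 < k ->
  {within `[c - h / 2, c + h / 2], continuous (u ^~ d)} ->
  (forall s, `|s - c| < h / 2 -> is_derive s 1 (u ^~ d) (f s d)) ->
  (forall s t, para c d h k s t ->
    [/\ is_derive s 1 (f ^~ t) (fx s t), is_derive t 1 (f s) (fy s t),
        is_derive s 1 (fx ^~ t) (fxx s t),
        is_derive s 1 (fy ^~ t) (fxy s t) & is_derive t 1 (fy s) (fyy s t)]) ->
  (forall s t, para c d h k s t ->
    [/\ `|fxx s t| <= M1, `|fxy s t| <= M2 & `|fyy s t| <= M3]) ->
  forall s t, para c d h k s t ->
  `|f s t + f (2 * c - s) (2 * d - t)
    - 2 * ((u (c + h / 2) d - u (c - h / 2) d) / h)|
  <= 2 * (h ^+ 2 * M1 + h * k * M2 + k ^+ 2 * M3).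
Proof.
move=> h0 k0 cu du D B s t P.
have [Ps _] := P; have Ph := para_height _ _ _ _ _ _ h0 k0 P.
have P' := para_sym _ _ _ _ _ _ P; have [Ps' _] := P'.
have Pc : para c d h k c d.
  by apply: para_mid => //; rewrite subrr normr0 divr_gt0.
have [M1ge0 M2ge0 M3ge0] : [/\ 0 <= M1, 0 <= M2 & 0 <= M3].
  by have [] := B _ _ Pc; split; apply: le_trans (normr_ge0 _) _; eassumption.
have mid a : `|a| < h / 2 -> `|f (c + a) d + f (c - a) d - 2 * f c d|
  <= 2 * M1 * a ^+ 2.
  apply: (second_difference_le (f ^~ d) (fx ^~ d) (fxx ^~ d)) => x xc.
  - by have [] := D _ _ (para_mid c d h k x h0 k0 xc).
  - by have [] := D _ _ (para_mid c d h k x h0 k0 xc).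
  - by have [] := B _ _ (para_mid c d h k x h0 k0 xc).
have HW : `|2 * ((u (c + h / 2) d - u (c - h / 2) d) / h) - 2 * f c d|
  <= h ^+ 2 / 2 * M1.
  (* subtracting the quadratic Taylor polynomial, whose increment over the
     symmetric interval is h * f c d *)
  pose p := fun s : R => f c d * (s - c) + fx c d / 2 * (s - c) ^+ 2.
  have dp s' : is_derive s' 1 p (f c d + fx c d * (s' - c)).
    apply: is_derive_eq.
    by rewrite /GRing.scale /= !subr0 !mulr1; field.
  have chc : c - h / 2 < c + h / 2 by have := divr_gt0 h0 (ltr0Sn R 1); lra.
  have [||x xr E] := @MVT R (fun s => u s d - p s)
      (fun s => f s d - (f c d + fx c d * (s - c))) _ _ chc.
  - move=> x; rewrite in_itv /= => xr; apply: is_deriveB.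
    by apply: du; rewrite ltr_norml; lra.
  - move=> x; apply: continuousB; first exact: cu.
    apply: continuous_subspaceT => y.
    by apply/differentiable_continuous/derivable1_diffP; have [] := dp y.
  have xc : `|x - c| < h / 2 by rewrite ltr_norml; move: xr;
    rewrite in_itv /= => ?; lra.
  have inI z : Num.min c x <= z <= Num.max c x -> `|z - c| < h / 2.
    by move: xc; rewrite !ltr_norml; case: (leP c x) => ? ? ?; lra.
  have [|y yr Ey] := MVT_between (f ^~ d) (fx ^~ d) c x.
    by move=> z zr; have [] := D _ _ (para_mid c d h k z h0 k0 (inI z zr)).
  have inJ z : Num.min c y <= z <= Num.max c y ->
    Num.min c x <= z <= Num.max c x.
    by move: yr; case: (leP c x); case: (leP c y) => ? ? ? ?; lra.
  have b := dist_le_deriv (fx ^~ d) (fxx ^~ d) c y M1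
    (fun z zr => let: And5 _ _ e _ _ := D _ _ (para_mid c d h k z h0 k0
      (inI z (inJ z zr))) in e)
    (fun z zr => let: And3 e _ _ := B _ _ (para_mid c d h k z h0 k0 (inI z
      (inJ z zr))) in e).
  have yc := inI y yr.
  have hp : p (c + h / 2) - p (c - h / 2) = h * f c d by rewrite /p; field.
  have {}E : (u (c + h / 2) d - u (c - h / 2) d) / h - f c d
    = (x - c) * (fx y d - fx c d).
    have -> : u (c + h / 2) d - u (c - h / 2) d =
       (u (c + h / 2) d - p (c + h / 2) - (u (c - h / 2) d - p (c - h / 2)))
       + h * f c d.
      by rewrite -hp; ring.
    have {}Ey : f x d = f c d + fx y d * (x - c) by rewrite -Ey; ring.
    rewrite E Ey; field; exact: lt0r_neq0.
  rewrite -mulrBr E !normrM ger0_norm //.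
  have b' := le_trans b (ler_wpM2l M1ge0 (ltW yc)).
  have := ler_pM (normr_ge0 _) (normr_ge0 _) (ltW xc) b'.
  by rewrite expr2; lra.
have legs : `|f s t - f s d + (f (2 * c - s) (2 * d - t) - f (2 * c - s) d)|
   <= 2 * k ^+ 2 * M3 + h * k * M2.
  have V x y z : para c d h k x y -> Num.min d y <= z <= Num.max d y ->
    para c d h k x z.
    exact: para_vert.
  have [x|x xr E1] := MVT_between (f s) (fy s) d t.
    by move=> xr; have [] := D _ _ (V _ _ _ P xr).
  have [y|y yr E2] := MVT_between (f (2 * c - s)) (fy (2 * c - s)) d
    (2 * d - t).
    by move=> yr; have [] := D _ _ (V _ _ _ P' yr).
  have -> : f s t - f s d + (f (2 * c - s) (2 * d - t) - f (2 * c - s) d)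
    = (t - d) * ((fy s x - fy s d) + (fy s d - fy (2 * c - s) d)
        - (fy (2 * c - s) y - fy (2 * c - s) d)) by rewrite E1 E2; ring.
  have sub a b e : Num.min d a <= b <= Num.max d a ->
      Num.min d b <= e <= Num.max d b -> Num.min d a <= e <= Num.max d a.
    by case: (leP d a); case: (leP d b) => ? ? ? ?; lra.
  have b1 := dist_le_deriv (fy s) (fyy s) d x M3
    (fun z zr => let: And5 _ _ _ _ e := D _ _ (V _ _ _ P
      (sub _ _ _ xr zr)) in e)
    (fun z zr => let: And3 _ _ e := B _ _ (V _ _ _ P (sub _ _ _ xr zr)) in e).
  have b2 := dist_le_deriv (fy (2 * c - s)) (fyy (2 * c - s)) d y M3
    (fun z zr => let: And5 _ _ _ _ e := D _ _ (V _ _ _ P'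
      (sub _ _ _ yr zr)) in e)
    (fun z zr => let: And3 _ _ e := B _ _ (V _ _ _ P' (sub _ _ _ yr zr)) in e).
  have H z : Num.min (2 * c - s) s <= z <= Num.max (2 * c - s) s ->
    `|z - c| < h / 2.
    by move: Ps; rewrite !ltr_norml; case: (leP (2 * c - s) s) => ? ? ?; lra.
  have b3 := dist_le_deriv (fy ^~ d) (fxy ^~ d) (2 * c - s) s M2
    (fun z zr => let: And5 _ _ _ e _ := D _ _ (para_mid c d h k z h0 k0
      (H z zr)) in e)
    (fun z zr => let: And3 _ e _ := B _ _ (para_mid c d h k z h0 k0
      (H z zr)) in e).
  have xd : `|x - d| <= k.
    by move: xr Ph; rewrite ler_norml ltr_norml; case: (leP d t) => ? ? ?; lra.
  have yd : `|y - d| <= k.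
    by move: yr Ph; rewrite ler_norml ltr_norml;
      case: (leP d (2 * d - t)) => ? ? ?; lra.
  have sd : `|s - (2 * c - s)| <= h.
    by move: Ps; rewrite ler_norml ltr_norml => ?; lra.
  rewrite normrM.
  have b1' := le_trans b1 (ler_wpM2l M3ge0 xd).
  have b2' := le_trans b2 (ler_wpM2l M3ge0 yd).
  have b3' := le_trans b3 (ler_wpM2l M2ge0 sd).
  have tot : `|fy s x - fy s d + (fy s d - fy (2 * c - s) d)
        - (fy (2 * c - s) y - fy (2 * c - s) d)| <= M3 * k + M2 * h + M3 * k.
    by rewrite (le_trans (ler_normB _ _)) // lerD // (le_trans
      (ler_normD _ _)) // lerD.
  apply: le_trans (ler_pM _ _ (ltW Ph) tot) _ => //.
  by rewrite le_eqVlt; apply/orP; left; apply/eqP; ring.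
have midb : `|f s d + f (2 * c - s) d - 2 * f c d| <= h ^+ 2 / 2 * M1.
  have := mid (s - c) Ps.
  have -> : c + (s - c) = s by ring.
  have -> : c - (s - c) = 2 * c - s by ring.
  move=> /le_trans; apply.
  have : (s - c) ^+ 2 <= (h / 2) ^+ 2.
    rewrite -[(s - c) ^+ 2]real_normK ?num_real // ler_pXn2r // ?nnegrE.
      exact: ltW.
    by rewrite divr_ge0 // ltW.
  by move=> /(ler_wpM2l M1ge0); rewrite expr_div_n; lra.
have -> : f s t + f (2 * c - s) (2 * d - t)
    - 2 * ((u (c + h / 2) d - u (c - h / 2) d) / h)
  = (f s t - f s d + (f (2 * c - s) (2 * d - t) - f (2 * c - s) d))
    + (f s d + f (2 * c - s) d - 2 * f c d)
    - (2 * ((u (c + h / 2) d - u (c - h / 2) d) / h) - 2 * f c d) by ring.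
apply: le_trans (ler_normB _ _) _.
apply: le_trans (lerD (ler_normD _ _) (lexx _)) _.
have hk : 0 <= h * k * M2 by rewrite !mulr_ge0 // ltW.
have hh : 0 <= h ^+ 2 * M1 by rewrite mulr_ge0 // exprn_ge0 // ltW.
by move: legs midb HW hk hh; rewrite -!mulrA; lra.
Qed.

End Parallelogram.

(** * Lebesgue measure on the plane *)

Section PlaneMeasure.
Context {R : realType}.
Local Notation plane := (measurableTypeR R * measurableTypeR R)%type.

(** The measurable sets of the plane are generated by rectangles, and every
    open set is a countable union of rectangles with rational corners. *)
Lemma open_plane_measurable (U : set (R * R)) : open U ->
  measurable (U : set plane).
Proof.
move=> oU.
pose box (q : (rat * rat) * (rat * rat)) : set plane :=
  `](ratr q.1.1 : R), ratr q.1.2[ `*` `](ratr q.2.1 : R), ratr q.2.2[.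
pose F q : set plane := if `[< box q `<=` U >] then box q else set0.
have -> : U = \bigcup_q F q.
  apply/seteqP; split => [p Up|p [q _]]; last first.
    by rewrite /F; case: asboolP => // h /h.
  have /nbhs_ballP[e /= e0 eU] : nbhs p U by exact: open_nbhs_nbhs.
  have rat_near (a : R) : exists b c : rat, [/\ ratr b < a, a < ratr c,
    a - e < ratr b & ratr c < a + e].
    have [|b] := @rat_in_itvoo R (a - e) a; first by lra.
    have [|c] := @rat_in_itvoo R a (a + e); first by lra.
    by rewrite !in_itv /= => /andP[? ?] /andP[? ?]; exists b, c.
  have [a [b [? ? ? ?]]] := rat_near p.1.
  have [c [d [? ? ? ?]]] := rat_near p.2.
  exists ((a, b), (c, d)) => //; rewrite /F; case: asboolP => [_|].
    by split; rewrite /= in_itv /=; apply/andP; split.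
  case=> -[s t] [] /=; rewrite !in_itv /= => /andP[? ?] /andP[? ?].
  by apply: eU; split; rewrite /ball /= ltr_norml; apply/andP; split; lra.
apply: countable_bigcupT_measurable => // q; rewrite /F; case: asboolP => // _.
by apply: measurableX; exact: measurable_itv.
Qed.

Lemma open_continuous_plane_measurable (U : set (R * R)) (f : R * R -> R) :
  open U -> (forall p, U p -> {for p, continuous f}) ->
  measurable_fun (U : set plane) (f : plane -> measurableTypeR R).
Proof.
move=> oU cf; apply: (measurability _ (RGenOpens.measurableE R)) =>
  _ [_ [a [b ->] <-]].
apply: open_plane_measurable; rewrite openE => p [Up fp].
apply: filterI; first exact: open_nbhs_nbhs.
by apply: cf => //; apply: open_nbhs_nbhs; split => //; exact: interval_open.
Qed.

Definition point_refl (c : R * R) (p : plane) : plane :=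
  (2 * c.1 - p.1, 2 * c.2 - p.2).

Lemma measurable_point_refl c : measurable_fun setT (point_refl c).
Proof. by apply/measurable_fun_pairP; split; apply: measurable_funB. Qed.

Lemma lebesgue_measure_refl (a : R) (A : set (measurableTypeR R)) :
  measurable A ->
  lebesgue_measure ((fun x : R => a - x) @^-1` A) = lebesgue_measure A.
Proof.
move=> mA.
pose r (x : measurableTypeR R) : measurableTypeR R := a - x.
have mr : measurable_fun setT r by apply: measurable_funB.
rewrite -[LHS]/(pushforward lebesgue_measure r A).
apply/esym/lebesgue_measure_unique => // _ [[x y] _ <-].
have E : r @^-1` `]x, y] = (`[a - y, a - x[%classic : set R).
  apply/seteqP; split => z; rewrite /r /= !in_itv /= => /andP[? ?].
    by apply/andP; split; lra.
  by apply/andP; split; lra.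
have L : lebesgue_measure (`]x, y]%classic : set R) =
    lebesgue_measure (`[a - y, a - x[%classic : set R).
  rewrite !lebesgue_measure_itv /= !lte_fin ltrD2l ltrN2.
  by case: ifP => // _; rewrite -!EFinD; congr EFin; ring.
exact: (etrans L (congr1 lebesgue_measure (esym E))).
Qed.

(** By uniqueness of the product measure it is enough to treat rectangles,
    that is, the reflections of the line. *)
Lemma area_refl c (A : set plane) : measurable A ->
  pushforward area (point_refl c) A = area A.
Proof.
move=> mA; apply/esym; apply: product_measure_unique => //.
  exact: measurable_point_refl.
move=> mr A1 A2 mA1 mA2.
have mp a (B : set (measurableTypeR R)) : measurable B ->
  measurable ((fun x : measurableTypeR R => a - x : measurableTypeR R) @^-1` B).
  by move=> mB; rewrite -[X in measurable X]setTI; apply: measurable_funB.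
transitivity (area (((fun x : R => 2 * c.1 - x) @^-1` A1) `*`
  ((fun x : R => 2 * c.2 - x) @^-1` A2))) => //.
rewrite /area product_measure1E; [|exact: mp..].
by congr mule; exact: lebesgue_measure_refl.
Qed.

Lemma area_vline (a : R) : area [set p : plane | p.1 = a] = 0%E.
Proof.
have -> : [set p : plane | p.1 = a] = [set a] `*` setT.
  by apply/seteqP; split => p //= -[].
by rewrite /area product_measure1E//; have /= -> := lebesgue_measure_set1 a;
  rewrite mul0e.
Qed.

Lemma measurable_affine (a b c : R) :
  measurable_fun setT (fun p : plane => a + b * p.1 + c * p.2).
Proof.
apply: measurable_funD; [apply: measurable_funD => //|];
  apply: measurable_funM => //.
Qed.

Lemma area_line (a b : R) : area [set p : plane | p.2 = a + b * p.1] = 0%E.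
Proof.
rewrite /area /product_measure1 /=.
apply: integral0_eq => x _ /=.
have -> : xsection [set p : plane | p.2 = a + b * p.1] x = [set a + b * x].
  by rewrite /xsection; apply/seteqP; split => y /=; rewrite inE.
exact: lebesgue_measure_set1.
Qed.

End PlaneMeasure.

(** * Integrals over centrally symmetric sets *)

Section CentralSymmetry.
Context {R : realType}.
Local Notation plane := (measurableTypeR R * measurableTypeR R)%type.
Local Notation mu := (@area R).
Local Open Scope ereal_scope.

Lemma bounded_integrable (P : set plane) (g : plane -> R) (B : R) :
  measurable P -> mu P < +oo -> measurable_fun P g ->
  (forall p, P p -> `|g p| <= B)%R -> mu.-integrable P (EFin \o g).
Proof.
move=> mP Pfin mg gB; apply: measurable_bounded_integrable => //.
exists B; split; first exact: num_real.
by move=> x Bx p Pp; exact: (le_trans (gB p Pp) (ltW Bx)).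
Qed.

Lemma point_reflK (c : R * R) : involutive (point_refl c).
Proof. by case=> x y; rewrite /point_refl /=; congr pair; ring. Qed.

Lemma point_refl_in (c : R * R) (P : set plane) p :
  (forall p, P p -> P (point_refl c p)) -> (point_refl c p \in P) = (p \in P).
Proof.
move=> symP; apply/idP/idP; rewrite !inE; last exact: symP.
by move/symP; rewrite point_reflK.
Qed.

Lemma measurable_comp_point_refl (c : R * R) (P : set plane) (g : plane -> R) :
  measurable P -> (forall p, P p -> P (point_refl c p)) ->
  measurable_fun P g -> measurable_fun P (g \o point_refl c).
Proof.
move=> mP symP mg; apply/(measurable_restrictT _ mP).
have -> : (g \o point_refl c) \_ P = (g \_ P) \o point_refl c.
  by apply/funext => p; rewrite /= !patchE point_refl_in.
apply: measurableT_comp; last exact: measurable_point_refl.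
exact/(measurable_restrictT _ mP).
Qed.

Lemma integral_point_refl (c : R * R) (P : set plane) (g : plane -> R) :
  measurable P -> (forall p, P p -> P (point_refl c p)) ->
  measurable_fun P g -> mu.-integrable P (EFin \o (g \o point_refl c)) ->
  \int[mu]_(p in P) (g p)%:E = \int[mu]_(p in P) (g (point_refl c p))%:E.
Proof.
move=> mP symP mg ig.
pose g0 : plane -> \bar R := (EFin \o g) \_ P.
have mg0 : measurable_fun setT g0.
  by apply/(measurable_restrictT _ mP); exact/measurable_EFinP.
have g0r : g0 \o point_refl c = (EFin \o (g \o point_refl c)) \_ P.
  by apply/funext => p; rewrite /g0 /= !patchE point_refl_in.
have ig0 : mu.-integrable (point_refl c @^-1` setT) (g0 \o point_refl c).
  by rewrite preimage_setT g0r; apply/(integrable_mkcond _ mP).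
have E := integral_pushforward (measurable_point_refl c) mg0 ig0 measurableT.
transitivity (\int[mu]_p g0 p); first by rewrite [LHS]integral_mkcond.
transitivity (\int[mu]_(p in point_refl c @^-1` setT) (g0 \o point_refl c) p).
  rewrite -E; apply: eq_measure_integral; first exact: measurable_point_refl.
  by move=> ? A mA _; exact: (esym (area_refl c _ mA)).
by rewrite preimage_setT g0r [RHS]integral_mkcond.
Qed.

(** The reflection in [c] preserves the integral of [f], so that twice the
    integral to be bounded is the integral of
    [f p + f (point_refl c p) - 2 * W]. *)
Lemma integral_symmetric_bound (c : R * R) (P : set plane) (f : plane -> R)
    (B W M : R) :
  measurable P -> mu P < +oo -> (forall p, P p -> P (point_refl c p)) ->
  measurable_fun P f -> (forall p, P p -> `|f p| <= B)%R ->
  (0 <= M)%R ->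
  (forall p, P p -> `|f p + f (point_refl c p) - 2 * W| <= 2 * M)%R ->
  `| \int[mu]_(p in P) (f p - W)%:E | <= M%:E * mu P.
Proof.
move=> mP Pfin symP mf fB M0 H.
pose g p := (f p - W)%R.
have mg : measurable_fun P g by apply: measurable_funB.
have gB p : P p -> (`|g p| <= B + `|W|)%R.
  by move=> Pp; rewrite (le_trans (ler_normB _ _))// lerD2r fB.
have mgr := measurable_comp_point_refl c P g mP symP mg.
have ig := bounded_integrable P g _ mP Pfin mg gB.
have igr := bounded_integrable P _ _ mP Pfin mgr (fun p Pp => gB _ (symP p Pp)).
have := integral_point_refl c P g mP symP mg igr.
set I := integral _ _ _ => EI.
have Ifin : I \is a fin_num by exact: (integrable_fin_num mP ig).
have : `|I + I| <= (2 * M)%:E * mu P.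
  rewrite [X in `|_ + X|]EI /I -(integralD_EFin mP ig igr).
  have mS : measurable_fun P (fun p => (EFin \o g) p + (EFin \o
    (g \o point_refl c)) p).
    by apply/measurable_EFinP; exact: measurable_funD mg mgr.
  apply: le_trans (le_abse_integral _ mP mS) _.
  apply: integral_le_bound mP mS _ _; first by rewrite lee_fin mulr_ge0.
  apply: aeW => p Pp; rewrite /= lee_fin /g (le_trans _ (H p Pp)) //.
  by rewrite le_eqVlt; apply/orP; left; apply/eqP; congr `|_|%R; ring.
rewrite -(fineK Ifin).
have Pf : mu P \is a fin_num by rewrite ge0_fin_numE.
rewrite -(fineK Pf) -EFinD -EFinM !abse_EFin lee_fin => h.
rewrite -EFinM lee_fin.
by move: h; rewrite -mulr2n normrMn mulr2n -mulrA; lra.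
Qed.

(** The closed cell [Q], its open parallelogram [P] and the union [G] of the
    open triangles differ by null sets. The values of [e] and [v] are only
    known on [G]; measurability on [Q] is what makes the remaining null set
    harmless. *)
Lemma cell_integral_bound (c : R * R) (Q P G : set plane) (f e v : plane -> R)
    (B W V M : R) :
  measurable Q -> measurable P -> measurable G ->
  G `<=` P -> P `<=` Q -> mu (Q `\` G) = 0 -> mu P < +oo ->
  (forall p, P p -> P (point_refl c p)) ->
  measurable_fun P f -> (forall p, P p -> `|f p| <= B)%R ->
  (0 <= M)%R ->
  (forall p, P p -> `|f p + f (point_refl c p) - 2 * W| <= 2 * M)%R ->
  measurable_fun Q e -> measurable_fun Q v ->
  (forall p, G p -> e p = f p - W /\ v p = V)%R ->
  `| \int[mu]_(p in Q) (e p * v p)%:E | <= M%:E * \int[mu]_(p in Q) `|(v p)%:E|.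
Proof.
move=> mQ mP mG GP PQ QG0 Pfin symP mf fB M0 H me mv HG.
have aeG : {ae mu, forall p, Q p -> G p}.
  exists (Q `\` G); split => //; first exact: measurableD.
  by move=> p /= /not_implyP.
pose g p := ((f p - W) * V)%R.
have mg : measurable_fun P g by apply: measurable_funM => //;
  apply: measurable_funB.
have -> : \int[mu]_(p in Q) (e p * v p)%:E =
    V%:E * \int[mu]_(p in P) (f p - W)%:E.
  transitivity (\int[mu]_(p in Q) ((EFin \o g) \_ P) p).
    apply: ae_eq_integral => //.
    - by apply/measurable_EFinP; apply: measurable_funM.
    - apply/(measurable_restrict _ _ _).1 => //; rewrite setIidr //.
      exact/measurable_EFinP.
    - apply: filterS aeG => p h Qp; have Gp := h Qp.
      have [-> ->] := HG _ Gp; rewrite patchE ifT // inE; exact: GP.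
  rewrite -integral_mkcondr setIidr //.
  have ig : mu.-integrable P (EFin \o (fun p => f p - W)%R).
    apply: (@bounded_integrable _ _ (B + `|W|)%R) => //; first
      by apply: measurable_funB.
    by move=> p Pp; rewrite (le_trans (ler_normB _ _))// lerD2r fB.
  rewrite -(integralZl mP ig).
  by apply: eq_integral => p _; rewrite /= /g mulrC EFinM.
have -> : \int[mu]_(p in Q) `|(v p)%:E| = `|V%:E| * mu Q.
  rewrite -integral_cst //.
  apply: ae_eq_integral => //.
  - by apply: measurableT_comp => //; apply/measurable_EFinP.
  - by apply: filterS aeG => p h Qp; have [_ ->] := HG _ (h Qp).
rewrite abseM muleCA lee_wpmul2l ?abse_ge0 //.
have := integral_symmetric_bound c P f B W M mP Pfin symP mf fB M0 H.
move=> /le_trans; apply.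
rewrite lee_wpmul2l // ?lee_fin // le_measure // inE //.
Qed.

Lemma open_area_gt0 (U : set (R * R)) p : open U -> U p -> 0 < mu U.
Proof.
move=> oU Up; have /nbhs_ballP[r /= r0 rU] : nbhs p U by exact: open_nbhs_nbhs.
pose box : set plane := `](p.1 - r)%R, (p.1 + r)%R[ `*` `](p.2 - r)%R,
  (p.2 + r)%R[.
have mbox : measurable box by apply: measurableX; exact: measurable_itv.
apply: (@lt_le_trans _ _ (mu box)); last first.
  apply: le_measure; rewrite ?inE //; first exact: open_plane_measurable.
  case=> x y [] /=; rewrite !in_itv /= => /andP[? ?] /andP[? ?].
  by apply: rU; split; rewrite /ball /= ltr_norml; apply/andP; split; lra.
have side (a : R) : 0 < lebesgue_measure (`](a - r)%R, (a + r)%R[%classic :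
  set R).
  rewrite lebesgue_measure_itv /= lte_fin ifT; last by lra.
  by rewrite -EFinD lte_fin; lra.
by rewrite /area product_measure1E //; apply: mule_gt0; exact: side.
Qed.

(** A continuous function exceeding its essential supremum somewhere would do
    so on a nonempty open set, which has positive area. *)
Lemma norm_Linfty_ge (D U : set (R * R)) (g : R * R -> R) :
  open U -> U `<=` D -> (forall p, U p -> {for p, continuous g}) ->
  forall p, U p -> (`|g p|)%:E <= norm_Linfty D g.
Proof.
move=> oU UD cg p Up; rewrite leNgt; apply/negP => lt.
have muT : 0 < mu setT by apply: (@open_area_gt0 _ p) => //; exact: openT.
have L0 : 0 <= norm_Linfty D g by exact: Lnorm_ge0.
have Lfin : norm_Linfty D g \is a fin_num.
  by rewrite ge0_fin_numE // (lt_le_trans lt) // leey.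
move: lt; rewrite -(fineK Lfin); set r := fine _ => lt; rewrite lte_fin in lt.
pose A := [set q | U q /\ (r < `|g q|)%R].
have oA : open A.
  rewrite openE => q [Uq rq].
  apply: filterI; first exact: open_nbhs_nbhs.
  have cq : {for q, continuous (fun q => `|g q|%R)}.
    by apply: continuous_comp; [exact: cg|exact: norm_continuous].
  have nr : nbhs (`|g q|%R : R) `]r, +oo[%classic.
    by apply: open_nbhs_nbhs; split; [exact: interval_open|
      rewrite /= in_itv /= rq].
  by apply: (@filterS _ (nbhs q) _ _ _ _ (cq _ nr)) => z;
    rewrite /= in_itv /= andbT.
have : mu A = 0.
  apply: measure_negligible; first exact: open_plane_measurable.
  have := ess_sup_ge mu (abse \o (EFin \o (g \_ D))).
  have -> : ess_sup mu (abse \o (EFin \o (g \_ D))) = r%:E.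
    by rewrite /r fineK // /norm_Linfty unlock muT.
  apply: negligibleS => q [Uq rq] /=; apply/negP; rewrite -ltNge lte_fin.
  by rewrite patchE ifT // inE; exact: UD.
by apply/eqP; rewrite gt_eqF // (@open_area_gt0 _ p).
Qed.

End CentralSymmetry.

(** * Partial derivatives on the open square *)

Set Implicit Arguments.
Unset Strict Implicit.

Section Regularity.
Context {R : realType}.
Implicit Types (f g : R * R -> R) (p : R * R) (s t : R).

Lemma is_derive_dx f s t : derivable f (s, t) ((1, 0) : R * R) ->
  is_derive s 1 (fun s => f (s, t)) (dx f (s, t)).
Proof.
have E : (fun h : R =>
    h^-1 *: ((f \o shift (s, t)) (h *: ((1, 0) : R * R)) - f (s, t)))
  = (fun h : R =>
    h^-1 *: (((fun s => f (s, t)) \o shift s) (h *: (1 : R)) - f (s, t))).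
  apply/funext => h /=; congr (_ *: (f _ - _)).
  by rewrite /= -[LHS]/(h *: (1 : R) + s, h *: (0 : R) + t) scaler0 add0r.
by rewrite /derivable /dx /derive E => d; apply: DeriveDef.
Qed.

Lemma is_derive_dy f s t : derivable f (s, t) ((0, 1) : R * R) ->
  is_derive t 1 (fun t => f (s, t)) (dy f (s, t)).
Proof.
have E : (fun h : R =>
    h^-1 *: ((f \o shift (s, t)) (h *: ((0, 1) : R * R)) - f (s, t)))
  = (fun h : R =>
    h^-1 *: (((fun t => f (s, t)) \o shift t) (h *: (1 : R)) - f (s, t))).
  apply/funext => h /=; congr (_ *: (f _ - _)).
  by rewrite /= -[LHS]/(h *: (0 : R) + s, h *: (1 : R) + t) scaler0 add0r.
by rewrite /derivable /dy /derive E => d; apply: DeriveDef.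
Qed.

Lemma open_Omega : open (@Omega R).
Proof.
rewrite openE => -[s t] [s01 t01]; exists (`]0, 1[%classic, `]0,
  1[%classic) => //.
by split; apply: open_nbhs_nbhs; split => //; exact: interval_open.
Qed.

Lemma compact_Omega_bar : compact (@Omega_bar R).
Proof. by apply: compact_setX; exact: segment_compact. Qed.

Lemma Omega_sub_bar : @Omega R `<=` Omega_bar.
Proof.
by move=> p [] /=; rewrite !in_itv /= =>
  /andP[/ltW a /ltW b] /andP[/ltW c /ltW d]; split; rewrite /= in_itv /= ?a ?c.
Qed.

Lemma dx_eq_on (U : set (R * R)) f g : open U -> (forall p, U p -> f p = g p) ->
  forall p, U p -> dx f p = dx g p.
Proof.
move=> oU fg p Up; apply: near_eq_derive.
by apply: filterS (open_nbhs_nbhs (conj oU Up)) => q /fg.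
Qed.

Lemma dy_eq_on (U : set (R * R)) f g : open U -> (forall p, U p -> f p = g p) ->
  forall p, U p -> dy f p = dy g p.
Proof.
move=> oU fg p Up; apply: near_eq_derive.
by apply: filterS (open_nbhs_nbhs (conj oU Up)) => q /fg.
Qed.

Lemma continuous_eq_on (U : set (R * R)) f g p : open U -> U p ->
  (forall q, U q -> f q = g q) -> {for p, continuous g} ->
    {for p, continuous f}.
Proof.
move=> oU Up fg cg; rewrite /prop_for /continuous_at fg //.
apply: cvg_trans cg; apply: near_eq_cvg.
by apply: filterS (open_nbhs_nbhs (conj oU Up)) => q /fg.
Qed.

Lemma C_Omega_bar_extension k f : C_Omega_bar k f ->
  exists2 g : R * R -> R, {within Omega_bar, continuous g}
                        & forall p, Omega p -> f p = g p.
Proof.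
by case: k => [|k] [[g cg fg] _]; exists g => // p Op; apply: fg; rewrite inE.
Qed.

Lemma C_Omega_bar_continuous k f : C_Omega_bar k f ->
  forall p, Omega p -> {for p, continuous f}.
Proof.
move=> /C_Omega_bar_extension [g cg fg] p Op.
apply: (continuous_eq_on open_Omega Op fg).
have := continuous_subspaceW Omega_sub_bar cg.
by rewrite (continuous_open_subspace _ open_Omega); apply; rewrite inE.
Qed.

Lemma C_Omega_bar_bounded k f : C_Omega_bar k f ->
  exists B, forall p, Omega p -> `|f p| <= B.
Proof.
move=> /C_Omega_bar_extension [g cg fg].
have /compact_bounded [M [_ HM]] := continuous_compact cg compact_Omega_bar.
exists (M + 1) => p Op; rewrite fg //.
by apply: (HM (M + 1)); [rewrite ltrDl|exists p => //; exact: Omega_sub_bar].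
Qed.

Lemma C_Omega_bar_dx k f : C_Omega_bar k.+1 f -> C_Omega_bar k (dx f).
Proof. by case=> _ []. Qed.

Lemma C_Omega_bar_dy k f : C_Omega_bar k.+1 f -> C_Omega_bar k (dy f).
Proof. by case=> _ []. Qed.

Lemma C_Omega_bar_mono k f : C_Omega_bar k.+1 f -> C_Omega_bar k f.
Proof.
elim: k f => [|k IH] f [Cf [df Cx Cy]]; split; [exact: Cf|exact: I|exact: Cf|].
by split; [exact: df|exact: (IH _ Cx)|exact: (IH _ Cy)].
Qed.

Lemma C_Omega_bar_derivable k f p : C_Omega_bar k.+1 f -> Omega p ->
  derivable f p ((1, 0) : R * R) /\ derivable f p ((0, 1) : R * R).
Proof. by case=> _ [+ _ _]; apply. Qed.

Lemma C_Omega_bar_is_derive_dx k f s t : C_Omega_bar k.+1 f -> Omega (s, t) ->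
  is_derive s 1 (fun s => f (s, t)) (dx f (s, t)).
Proof.
by move=> Cf O; apply: is_derive_dx; have [] := C_Omega_bar_derivable Cf O.
Qed.

Lemma C_Omega_bar_is_derive_dy k f s t : C_Omega_bar k.+1 f -> Omega (s, t) ->
  is_derive t 1 (fun t => f (s, t)) (dy f (s, t)).
Proof.
by move=> Cf O; apply: is_derive_dy; have [] := C_Omega_bar_derivable Cf O.
Qed.

(** Both derivatives are values, at points close to [p], of the same second
    mixed difference of [f] over a small square, divided by the area of the
    square. *)
Lemma dx_dyC f p : C_Omega_bar 2 f -> Omega p -> dx (dy f) p = dy (dx f) p.
Proof.
case: p => s t Cf Op.
have Cx := C_Omega_bar_dx Cf; have Cy := C_Omega_bar_dy Cf.
have cxy := C_Omega_bar_continuous (C_Omega_bar_dx Cy) Op.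
have cyx := C_Omega_bar_continuous (C_Omega_bar_dy Cx) Op.
apply/eqP; rewrite -subr_eq0 -normr_le0.
apply/ler_addgt0Pl => /= e e0; move: (e : R) e0 => {}e e0; rewrite addr0.
have e2 : 0 < e / 2 by rewrite divr_gt0.
have n0 : nbhs ((s, t) : R * R) (@Omega R) by apply: open_nbhs_nbhs;
  split => //; exact: open_Omega.
have n1 : nbhs ((s, t) : R * R)
    [set q : R * R | `|dx (dy f) (s, t) - dx (dy f) q| < e / 2].
  by move/cvgrPdist_lt: cxy; apply.
have n2 : nbhs ((s, t) : R * R)
    [set q : R * R | `|dy (dx f) (s, t) - dy (dx f) q| < e / 2].
  by move/cvgrPdist_lt: cyx; apply.
have [r r0 Hr] : exists2 r : R, 0 < r & forall q, ball ((s, t) : R * R) r q ->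
    [/\ Omega q, `|dx (dy f) (s, t) - dx (dy f) q| < e / 2
      & `|dy (dx f) (s, t) - dy (dx f) q| < e / 2].
  have /nbhs_ballP [r0 /= r0_gt0 H0] := n0.
  have /nbhs_ballP [r1 /= r1_gt0 H1] := n1.
  have /nbhs_ballP [r2 /= r2_gt0 H2] := n2.
  exists (Num.min r0 (Num.min r1 r2)); first by rewrite !lt_min r0_gt0 r1_gt0.
  have lr0 : Num.min r0 (Num.min r1 r2) <= r0 by rewrite ge_min lexx.
  have lr1 : Num.min r0 (Num.min r1 r2) <= r1 by rewrite !ge_min lexx orbT.
  have lr2 : Num.min r0 (Num.min r1 r2) <= r2 by rewrite !ge_min lexx !orbT.
  by move=> q Bq; split; [apply/H0/(le_ball lr0)|apply/H1/(le_ball lr1)|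
    apply/H2/(le_ball lr2)].
have [h h0 hr] : exists2 h : R, 0 < h & h < r by exists (r / 2); lra.
have inb x y : s <= x <= s + h -> t <= y <= t + h -> ball (s, t) r (x, y).
  by move=> /andP[? ?] /andP[? ?]; split; rewrite /ball /= ltr_norml;
    apply/andP; split; lra.
have mmE a x : Num.min a (a + h) <= x <= Num.max a (a + h) -> a <= x <= a + h.
  have ah : a <= a + h by lra.
  by rewrite min_l // max_r.
have l1 a : a <= a <= a + h by apply/andP; split => //; lra.
have l2 a : a <= a + h <= a + h by apply/andP; split => //; lra.
pose D := f (s + h, t + h) - f (s + h, t) - (f (s, t + h) - f (s, t)).
have [x [y [xr yr E1]]] : exists x y,
    [/\ s <= x <= s + h, t <= y <= t + h & D = dy (dx f) (x, y) * h * h].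
  have [|x /mmE xr E] := MVT_between (fun x => f (x, t + h) - f (x, t))
     (fun x => dx f (x, t + h) - dx f (x, t)) s (s + h).
    move=> z /mmE zr; apply: is_deriveB; apply: (C_Omega_bar_is_derive_dx Cf).
      by have [] := Hr _ (inb _ _ zr (l2 t)).
    by have [] := Hr _ (inb _ _ zr (l1 t)).
  have [|y /mmE yr E'] := MVT_between (fun y => dx f (x, y)) (fun y =>
    dy (dx f) (x, y)) t (t + h).
    by move=> z /mmE zr; apply: (C_Omega_bar_is_derive_dy Cx); have [] :=
      Hr _ (inb _ _ xr zr).
  exists x, y; split; [exact: xr|exact: yr|rewrite /D].
  have sh z : z + h - z = h by ring.
  by rewrite E' !sh in E; rewrite -E; ring.
have [x' [y' [xr' yr' E2]]] : exists x y,
    [/\ s <= x <= s + h, t <= y <= t + h & D = dx (dy f) (x, y) * h * h].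
  have [|y' /mmE yr' E] := MVT_between (fun y => f (s + h, y) - f (s, y))
     (fun y => dy f (s + h, y) - dy f (s, y)) t (t + h).
    move=> z /mmE zr; apply: is_deriveB; apply: (C_Omega_bar_is_derive_dy Cf).
      by have [] := Hr _ (inb _ _ (l2 s) zr).
    by have [] := Hr _ (inb _ _ (l1 s) zr).
  have [|x' /mmE xr' E'] := MVT_between (fun x => dy f (x, y')) (fun x =>
    dx (dy f) (x, y')) s (s + h).
    by move=> z /mmE zr; apply: (C_Omega_bar_is_derive_dx Cy); have [] :=
      Hr _ (inb _ _ zr yr').
  exists x', y'; split; [exact: xr'|exact: yr'|rewrite /D].
  have sh z : z + h - z = h by ring.
  by rewrite E' !sh in E; rewrite -E; ring.
have [_ _ b1] := Hr _ (inb _ _ xr yr).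
have [_ b2 _] := Hr _ (inb _ _ xr' yr').
have EE : dy (dx f) (x, y) = dx (dy f) (x', y').
  have hn : h != 0 by rewrite gt_eqF.
  by move: (etrans (esym E1) E2) => /(mulIf hn)/(mulIf hn).
move: b1 b2; rewrite EE; clear.
move: (dx (dy f) (s, t)) (dx (dy f) (x', y')) (dy (dx f) (s, t)) => a b c Hc Ha.
by rewrite ler_norml; move: Ha Hc; rewrite !ltr_norml; lra.
Qed.

End Regularity.

(** * Right triangles and their unions *)

Section RightTriangles.
Context {R : realType}.
Local Notation plane := (measurableTypeR R * measurableTypeR R)%type.
Implicit Types (X Y h k s t : R).

(** The closed right triangle with legs [h] and [k] at the corner [(X, Y)], in
    the coordinates that make it the unit simplex. The legs are signed: both
    kinds of triangle of the mesh have this form, with opposite signs. *)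
Definition rtri X Y h k s t : Prop :=
  [/\ 0 <= (s - X) / h, 0 <= (t - Y) / k & (s - X) / h + (t - Y) / k <= 1].

Definition ortri X Y h k s t : Prop :=
  [/\ 0 < (s - X) / h, 0 < (t - Y) / k & (s - X) / h + (t - Y) / k < 1].

Lemma rtri_swap X Y h k s t : rtri X Y h k s t -> rtri Y X k h t s.
Proof. by case=> a b c; split => //; rewrite addrC. Qed.

Lemma ortri_swap X Y h k s t : ortri X Y h k s t -> ortri Y X k h t s.
Proof. by case=> a b c; split => //; rewrite addrC. Qed.

Lemma ortriW X Y h k s t : ortri X Y h k s t -> rtri X Y h k s t.
Proof. by case=> /ltW a /ltW b /ltW c. Qed.

Lemma rtri_corner X Y h k : rtri X Y h k X Y.
Proof. by rewrite /rtri !subrr !mul0r addr0; split. Qed.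

Lemma rtri_leg X Y h k : h != 0 -> rtri X Y h k (X + h) Y.
Proof.
move=> h0; rewrite /rtri subrr mul0r addr0 (_ : (X + h - X) / h = 1); first
  by split.
by field.
Qed.

Lemma triangle_K1 X Y h k : h != 0 -> k != 0 ->
  triangle (X, Y) (X + h, Y) (X, Y + k) = [set p | rtri X Y h k p.1 p.2].
Proof.
move=> h0 k0; apply/seteqP; split => [p [r [s [t [[r0 s0 t0 E] ->]]]] /=|
  [x y] /= [a b c]].
  have -> : r = 1 - s - t by rewrite -E; ring.
  rewrite /rtri.
  have -> : ((1 - s - t) * X + s * (X + h) + t * X - X) / h = s by field.
  have -> : ((1 - s - t) * Y + s * Y + t * (Y + k) - Y) / k = t by field.
  by split => //; lra.
exists (1 - (x - X) / h - (y - Y) / k), ((x - X) / h), ((y - Y) / k).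
by split; [split => //; lra|congr pair => /=; field; rewrite ?h0 ?k0].
Qed.

Lemma triangle_K2 X Y h k : h != 0 -> k != 0 ->
  triangle (X - h, Y) (X, Y - k) (X, Y) =
  [set p | rtri X Y (- h) (- k) p.1 p.2].
Proof.
move=> h0 k0; apply/seteqP; split => [p [r [s [t [[r0 s0 t0 E] ->]]]] /=|
  [x y] /= [a b c]].
  have -> : t = 1 - r - s by rewrite -E; ring.
  rewrite /rtri.
  have -> : (r * (X - h) + s * X + (1 - r - s) * X - X) / - h = r by field.
  have -> : (r * Y + s * (Y - k) + (1 - r - s) * Y - Y) / - k = s by field.
  by split => //; lra.
exists ((x - X) / - h), ((y - Y) / - k), (1 - (x - X) / - h - (y - Y) / - k).
by split; [split => //; lra|congr pair => /=; field; rewrite ?h0 ?k0].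
Qed.

Let affine_continuous (a b c : R) :
  continuous (fun p : R * R => a + b * p.1 + c * p.2).
Proof.
move=> p; apply: cvgD; [apply: cvgD; [exact: cvg_cst|]|].
  by apply: cvgM; [exact: cvg_cst|exact: cvg_fst].
by apply: cvgM; [exact: cvg_cst|exact: cvg_snd].
Qed.

Lemma open_affine_lt (a b c : R) :
  open [set p : R * R | a + b * p.1 + c * p.2 < 0].
Proof.
have := (@affine_continuous a b c); rewrite continuousP =>
  /(_ `]-oo, 0[%classic).
have -> : (fun p : R * R => a + b * p.1 + c * p.2) @^-1` `]-oo, 0[
  = [set p : R * R | a + b * p.1 + c * p.2 < 0].
  by apply/seteqP; split => p /=; rewrite in_itv.
by apply; exact: interval_open.
Qed.

Lemma ortri_open X Y h k : open [set p : R * R | ortri X Y h k p.1 p.2].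
Proof.
have -> : [set p : R * R | ortri X Y h k p.1 p.2] =
  [set p : R * R | X / h + - h^-1 * p.1 + 0 * p.2 < 0] `&`
  ([set p : R * R | Y / k + 0 * p.1 + - k^-1 * p.2 < 0] `&`
  [set p : R * R | (- X / h - Y / k - 1) + h^-1 * p.1 + k^-1 * p.2 < 0]).
  by apply/seteqP; split => p /= => [[]|[? []]]; rewrite /ortri; split; lra.
by apply: openI; [|apply: openI]; exact: open_affine_lt.
Qed.

Lemma rtri_measurable X Y h k :
  measurable ([set p | rtri X Y h k p.1 p.2] : set plane).
Proof.
have mle (a b c : R) :
    measurable ([set p | 0 <= a + b * p.1 + c * p.2] : set plane).
  have -> : [set p : plane | 0 <= a + b * p.1 + c * p.2]
    = ~` [set p | a + b * p.1 + c * p.2 < 0].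
    by apply/seteqP; split => p /=; rewrite leNgt => /negP.
  by apply: measurableC; apply: open_plane_measurable; exact: open_affine_lt.
have -> : [set p : plane | rtri X Y h k p.1 p.2] =
  [set p | 0 <= - X / h + h^-1 * p.1 + 0 * p.2] `&`
  ([set p | 0 <= - Y / k + 0 * p.1 + k^-1 * p.2] `&`
  [set p | 0 <= (1 + X / h + Y / k) + - h^-1 * p.1 + - k^-1 * p.2]).
  by apply/seteqP; split => p /= => [[]|[? []]]; rewrite /rtri; split; lra.
by apply: measurableI; [|apply: measurableI]; exact: mle.
Qed.

Lemma measurable_affine_eq0 (a b c : R) :
  measurable ([set p | a + b * p.1 + c * p.2 = 0] : set plane).
Proof.
rewrite -[X in measurable X]setTI -/((fun p : plane =>
  a + b * p.1 + c * p.2) @^-1` [set 0]).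
exact: measurable_affine.
Qed.

(** The difference lies on the three lines that carry the sides. *)
Lemma rtri_boundary_null X Y h k : h != 0 -> k != 0 ->
  (@area R).-negligible
    ([set p | rtri X Y h k p.1 p.2] `\` [set p | ortri X Y h k p.1 p.2]).
Proof.
move=> h0 k0.
have vl : (@area R).-negligible [set p | p.1 = X].
  exists [set p | p.1 = X]; split => //; last exact: area_vline.
  have -> : [set p : plane | p.1 = X] = [set p | - X + 1 * p.1 + 0 * p.2 = 0].
    by apply/seteqP; split => p /=; lra.
  exact: measurable_affine_eq0.
have l a b : (@area R).-negligible [set p | p.2 = a + b * p.1].
  exists [set p | p.2 = a + b * p.1]; split => //; last exact: area_line.
  have -> : [set p : plane | p.2 = a + b * p.1]
    = [set p | a + b * p.1 + - 1 * p.2 = 0].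
    by apply/seteqP; split => p /=; lra.
  exact: measurable_affine_eq0.
apply: negligibleS (negligibleU vl (negligibleU (l Y 0) (l
  (Y + k + k / h * X) (- (k / h))))).
move=> p [[a b c] no].
have [E1|/eqP E1] := eqVneq (p.1 - X) 0; first by left; rewrite /=; lra.
have [E2|/eqP E2] := eqVneq (p.2 - Y) 0; first by right; left; rewrite /=; lra.
right; right => /=.
have [E|E] : (p.1 - X) / h + (p.2 - Y) / k = 1 \/ (p.1 - X) / h +
  (p.2 - Y) / k < 1.
- by move: c; rewrite le_eqVlt => /orP[/eqP|]; [left|right].
- have -> : p.2 = Y + k * ((p.1 - X) / h + (p.2 - Y) / k - (p.1 - X) / h)
  by field; rewrite h0 k0.
  by rewrite E; field.
- case: no; split => //; rewrite lt0r ?a ?b andbT mulf_neq0 ?invr_neq0 //;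
  exact/eqP.
Qed.

(** In the coordinates of the triangle with corner [(X, Y)], the parallelogram
    is cut out by four inequalities with coefficients 0 and 1. *)
Lemma para_coord X Y h k s t : 0 < h -> 0 < k -> para (X + h / 2) Y h k s t <->
  [/\ 0 < (s - X) / h, (s - X) / h < 1, 0 < (s - X) / h + (t - Y) / k &
      (s - X) / h + (t - Y) / k < 1].
Proof.
move=> h0 k0; rewrite /para.
have hn : h != 0 by rewrite gt_eqF.
have kn : k != 0 by rewrite gt_eqF.
set a := (s - X) / h; set b := (t - Y) / k.
have -> : s - (X + h / 2) = (a - 1 / 2) * h by rewrite /a; field.
have -> : t - Y + k / h * ((a - 1 / 2) * h) = (a + b - 1 / 2) * k.
  by rewrite /a /b; field; rewrite hn kn.
rewrite !normrM (gtr0_norm h0) (gtr0_norm k0) ![_ / 2 as X in _ < X]mulrC.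
rewrite !ltr_pM2r // !ltr_norml.
by split=> [[/andP[? ?] /andP[? ?]]|[? ? ? ?]]; repeat split; try (apply/andP;
  split); lra.
Qed.

(** The two triangles share the leg from [(X, Y)] to [(X + h, Y)], whose
    midpoint is the centre of the parallelogram. *)
Lemma ortri_para X Y h k s t : 0 < h -> 0 < k ->
  ortri (X + h) Y (- h) (- k) s t \/ ortri X Y h k s t ->
    para (X + h / 2) Y h k s t.
Proof.
move=> h0 k0; rewrite para_coord // => -[|] [].
  have -> : (s - (X + h)) / - h = 1 - (s - X) / h by field; rewrite gt_eqF.
  have -> : (t - Y) / - k = - ((t - Y) / k) by field; rewrite gt_eqF.
  by split; lra.
by split; lra.
Qed.

Lemma para_rtri X Y h k s t : 0 < h -> 0 < k -> para (X + h / 2) Y h k s t ->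
  rtri (X + h) Y (- h) (- k) s t \/ rtri X Y h k s t.
Proof.
move=> h0 k0; rewrite para_coord // => -[? ? ? ?].
have [b0|b0] := leP 0 ((t - Y) / k); [right|left].
  by split; lra.
rewrite /rtri.
have -> : (s - (X + h)) / - h = 1 - (s - X) / h by field; rewrite gt_eqF.
have -> : (t - Y) / - k = - ((t - Y) / k) by field; rewrite gt_eqF.
by split; lra.
Qed.

Lemma para_open X Y h k : 0 < h -> 0 < k ->
  open [set p : R * R | para (X + h / 2) Y h k p.1 p.2].
Proof.
move=> h0 k0.
have -> : [set p : R * R | para (X + h / 2) Y h k p.1 p.2] =
  [set p : R * R | X / h + - h^-1 * p.1 + 0 * p.2 < 0] `&`
  ([set p : R * R | (- X / h - 1) + h^-1 * p.1 + 0 * p.2 < 0] `&`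
  ([set p : R * R | (X / h + Y / k) + - h^-1 * p.1 + - k^-1 * p.2 < 0] `&`
  [set p : R * R | (- X / h - Y / k - 1) + h^-1 * p.1 + k^-1 * p.2 < 0])).
  apply/seteqP; split => p /=; rewrite para_coord //.
    by case=> *; repeat split; lra.
  by case=> ? [? [? ?]]; split; lra.
by apply: openI; [|apply: openI; [|apply: openI]]; exact: open_affine_lt.
Qed.

Lemma open_swap (A : set (R * R)) : open A ->
  open [set p : R * R | A (p.2, p.1)].
Proof.
move=> oA; have cs : continuous (fun p : R * R => (p.2, p.1)).
  by move=> p; exact: swap_continuous.
by apply: (@open_comp _ _ (fun p : R * R => (p.2, p.1)) A) => // p _; exact: cs.
Qed.

End RightTriangles.

(** * The Shishkin mesh *)

Section ShishkinMesh.
Context {R : realType}.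
Implicit Types (lam : R) (N i : nat).

Lemma step_shishkin lam N i : (0 < N./2)%N ->
  step (shishkin lam N) i = (if (i < N./2)%N then 1 - lam else lam) / N./2%:R.
Proof.
move=> N0; have N0' : N./2%:R != 0 :> R by rewrite pnatr_eq0 -lt0n.
rewrite /step /shishkin; case: ltngtP => [iM|Mi|->].
- by rewrite -(natr1 i); field.
- by rewrite subSn ?(ltnW Mi) // -natr1; field.
- by rewrite subSnn; field.
Qed.

Lemma shishkin0 lam N : shishkin lam N 0 = 0.
Proof. by rewrite /shishkin leq0n mul0r. Qed.

Lemma shishkinN lam N : (0 < N./2)%N -> ~~ odd N -> shishkin lam N N = 1.
Proof.
move=> N0 evenN; have N0' : N./2%:R != 0 :> R by rewrite pnatr_eq0 -lt0n.
rewrite -{2}(even_halfK evenN) /shishkin -addnn leqNgt -[X in (X < _)%N]addn0.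
by rewrite ltn_add2l N0 /= addnK; field.
Qed.

Definition unit_mesh (x : nat -> R) N :=
  [/\ x 0%N = 0, x N = 1 & forall i, (i < N)%N -> 0 < step x i].

Lemma shishkin_unit_mesh lam N : (4 <= N)%N -> ~~ odd N -> 0 < lam ->
  lam <= 1 / 2 ->
  unit_mesh (shishkin lam N) N.
Proof.
move=> N4 evenN l0 l1.
have N0 : (0 < N./2)%N by rewrite half_gt0 (leq_trans _ N4).
split; [exact: shishkin0|exact: shishkinN|].
by move=> i _; rewrite step_shishkin // divr_gt0 ?ltr0n //; case: ifP => // _;
  lra.
Qed.

Lemma unit_mesh_range x N i : unit_mesh x N -> (i <= N)%N -> 0 <= x i <= 1.
Proof.
case=> x0 xN xs iN; apply/andP; split.
  rewrite -x0; elim: i iN => [|i IH] iN //.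
  by have := xs _ iN; rewrite /step subr_gt0 => /ltW; apply: le_trans;
    apply: IH; exact: ltnW.
rewrite -xN -[X in x X <= _](subKn iN).
elim: (N - i)%N (leq_subr i N) => [|n IH] nN; first by rewrite subn0.
apply: le_trans (IH (ltnW nN)).
have := xs (N - n.+1)%N; rewrite /step subnSK // subr_gt0 => lt.
by apply/ltW/lt; exact: leq_subr.
Qed.

End ShishkinMesh.

(** * Elementwise derivatives of piecewise linear functions *)

Section ElementwiseDerivative.
Context {R : realType}.
Local Notation plane := (measurableTypeR R * measurableTypeR R)%type.
Implicit Types (f g w : R * R -> R) (p v : R * R).

Lemma triangle_sub_Omega_bar (a b c : R * R) :
  Omega_bar a -> Omega_bar b -> Omega_bar c -> triangle a b c `<=` Omega_bar.
Proof.
have avg (r s t u u' u'' : R) : 0 <= r -> 0 <= s -> 0 <= t -> r + s + t = 1 ->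
    0 <= u <= 1 -> 0 <= u' <= 1 -> 0 <= u'' <= 1 ->
      0 <= r * u + s * u' + t * u'' <= 1.
  move=> r0 s0 t0 E /andP[? ?] /andP[? ?] /andP[? ?].
  apply/andP; split; first by rewrite !addr_ge0 // mulr_ge0.
  by rewrite -E !lerD // -[leRHS]mulr1 ler_wpM2l.
move=> [a1 a2] [b1 b2] [c1 c2] p [r [s [t [[r0 s0 t0 E] ->]]]].
by move: a1 a2 b1 b2 c1 c2; rewrite /= !in_itv /= => *; split;
  rewrite /= in_itv /=; exact: avg.
Qed.

Lemma interior_Omega_bar : (@Omega_bar R)° `<=` Omega.
Proof.
move=> [s t] /nbhs_ballP [r /= r0 H].
have r2 : 0 < r / 2 by rewrite divr_gt0.
have [] : Omega_bar (s - r / 2, t - r / 2).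
  by apply: H; split; rewrite /ball /= ltr_norml; apply/andP; split; lra.
have [] : Omega_bar (s + r / 2, t + r / 2).
  by apply: H; split; rewrite /ball /= ltr_norml; apply/andP; split; lra.
rewrite /= !in_itv /= => /andP[? ?] /andP[? ?] /andP[? ?] /andP[? ?].
by split; rewrite /= in_itv /=; apply/andP; split; lra.
Qed.

Lemma unit_mesh_Omega_bar (x y : nat -> R) N i j : unit_mesh x N ->
  unit_mesh y N ->
  (i <= N)%N -> (j <= N)%N -> Omega_bar (x i, y j).
Proof.
move=> mx my iN jN; have xi := unit_mesh_range mx iN; have yj :=
  unit_mesh_range my jN.
by split; rewrite /= in_itv.
Qed.

Lemma triangulation_sub_Omega_bar (x y : nat -> R) N K : unit_mesh x N ->
  unit_mesh y N ->
  triangulation x y N K -> K `<=` Omega_bar.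
Proof.
move=> mx my [i [j [iN jN K12]]].
have iN' := ltnW iN; have jN' := ltnW jN.
by case: K12 => ->; apply: triangle_sub_Omega_bar;
  exact: (unit_mesh_Omega_bar mx my).
Qed.

Lemma triangulation_interior (x y : nat -> R) N K : unit_mesh x N ->
  unit_mesh y N ->
  triangulation x y N K -> K° `<=` Omega.
Proof.
move=> mx my TK; apply: subset_trans interior_Omega_bar.
by apply: interiorS; exact: triangulation_sub_Omega_bar TK.
Qed.

Lemma is_derive_affine (a b c : R) p v :
  is_derive p v (fun p => a + b * p.1 + c * p.2) (b * v.1 + c * v.2).
Proof.
have H : (fun h : R =>
    h^-1 *: (((fun p => a + b * p.1 + c * p.2) \o shift p) (h *: v)
     - (a + b * p.1 + c * p.2))) @ 0^' --> b * v.1 + c * v.2.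
  apply: cvg_near_cst; near=> h.
  have h0 : h != 0 by near: h; exact: nbhs_dnbhs_neq.
  by rewrite /= /GRing.scale /= /GRing.scale /=; field.
by apply: DeriveDef; [apply/cvg_ex; exists (b * v.1 + c * v.2)|apply: cvg_lim].
Unshelve. all: by end_near. Qed.

Lemma derive_affine_on (K : set (R * R)) f (a b c : R) v :
  (forall p, K p -> f p = a + b * p.1 + c * p.2) ->
  forall p, K° p -> is_derive p v f (b * v.1 + c * v.2).
Proof.
move=> Kf p Kp; apply: near_eq_is_derive (is_derive_affine a b c p v).
by apply: filterS Kp => q Kq; rewrite Kf.
Qed.

Context (x y : nat -> R) (N : nat).
Context (mx : unit_mesh x N) (my : unit_mesh y N).

(** The common generalization of [elt_dx] and [elt_dy], to which it is
    convertible for [v = (1, 0)] and [v = (0, 1)]. *)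
Definition elt_D v f : R * R -> R := 'D_v f \_ (mesh_interior x y N).

Lemma open_mesh_interior : open (mesh_interior x y N).
Proof. by apply: bigcup_open => K _; exact: open_interior. Qed.

(** Measurability is needed even though only almost everywhere values matter,
    because the product measure is not complete. *)
Lemma elt_D_measurable v f :
  (forall K p, triangulation x y N K -> K° p -> {for p, continuous ('D_v f)}) ->
  measurable_fun setT (elt_D v f : plane -> measurableTypeR R).
Proof.
move=> cf; apply/(measurable_restrictT _
  (open_plane_measurable _ open_mesh_interior)).
apply: open_continuous_plane_measurable; first exact: open_mesh_interior.
by move=> p [K TK Kp]; exact: cf TK Kp.
Qed.

Lemma elt_D_pw_linear K f (a b c : R) v p : triangulation x y N K ->
  (forall p, K p -> f p = a + b * p.1 + c * p.2) -> K° p ->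
  elt_D v f p = b * v.1 + c * v.2.
Proof.
move=> TK Kf Kp; rewrite /elt_D patchE ifT; last by rewrite inE; exists K.
by have [_] := derive_affine_on v Kf Kp.
Qed.

Lemma elt_D_error K w f (a b c : R) v p : triangulation x y N K ->
  (forall p, K p -> f p = a + b * p.1 + c * p.2) -> derivable w p v -> K° p ->
  elt_D v (w \- f) p = 'D_v w p - (b * v.1 + c * v.2).
Proof.
move=> TK Kf dw Kp; rewrite /elt_D patchE ifT; last by rewrite inE; exists K.
have [df <-] := derive_affine_on v Kf Kp.
exact: deriveB.
Qed.

Lemma elt_D_pw_linear_measurable v f : pw_linear x y N f ->
  measurable_fun setT (elt_D v f : plane -> measurableTypeR R).
Proof.
move=> [_ Lf]; apply: elt_D_measurable => K p TK Kp.
have [a [b [c Kf]]] := Lf K TK.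
apply: (@continuous_eq_on _ K° _ (cst (b * v.1 + c * v.2))) => //.
- exact: open_interior.
- by move=> q Kq; have [_] := derive_affine_on v Kf Kq.
- exact: cst_continuous.
Qed.

Lemma elt_D_error_measurable v w f : pw_linear x y N f ->
  (forall p, Omega p -> derivable w p v /\ {for p, continuous ('D_v w)}) ->
  measurable_fun setT (elt_D v (w \- f) : plane -> measurableTypeR R).
Proof.
move=> [_ Lf] Hw; apply: elt_D_measurable => K p TK Kp.
have [a [b [c Kf]]] := Lf K TK.
have KO := triangulation_interior mx my TK.
apply: (@continuous_eq_on _ K° _ (fun q => 'D_v w q - (b * v.1 + c * v.2))) =>
  //.
- exact: open_interior.
- move=> q Kq; have [dw _] := Hw q (KO q Kq).
  have [df <-] := derive_affine_on v Kf Kq.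
  exact: deriveB.
- by have [_ cw] := Hw p (KO p Kp); apply: continuousB => //;
  exact: cst_continuous.
Qed.

End ElementwiseDerivative.

(** * Norms of derivatives over a cell *)

Section Norms.
Context {R : realType}.
Implicit Types (f g w : R * R -> R) (p v : R * R) (D U : set (R * R)).

Lemma norm_L1E D f : norm_L1 D f = (\int[area]_(p in D) `|(f p)%:E|)%E.
Proof.
rewrite /norm_L1 Lnorm1 [RHS]integral_mkcond; apply: eq_integral => p _ /=.
by rewrite !patchE; case: ifP => // _; rewrite normr0.
Qed.

Lemma norm_Linfty_le D f (B : R) : 0 <= B -> (forall p, `|f p| <= B) ->
  (norm_Linfty D f <= B%:E)%E.
Proof.
move=> B0 fB; rewrite /norm_Linfty unlock; case: ifP => // _.
apply: ess_sup_ler => p; rewrite lee_fin patchE; case: ifP => // _.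
by rewrite normr0.
Qed.

Lemma C_Omega_bar_iter_dx l k f : C_Omega_bar (l + k) f ->
  C_Omega_bar k (iter l dx f).
Proof.
elim: l k => [//|l IH] k Cf; apply: C_Omega_bar_dx.
by apply: IH; rewrite addnS.
Qed.

Lemma C_Omega_bar_iter_dy l k f : C_Omega_bar (l + k) f ->
  C_Omega_bar k (iter l dy f).
Proof.
elim: l k => [//|l IH] k Cf; apply: C_Omega_bar_dy.
by apply: IH; rewrite addnS.
Qed.

Lemma C_Omega_bar_dxy l m w : C_Omega_bar (l + m) w ->
  C_Omega_bar 0 (iter l dx (iter m dy w)).
Proof.
move=> Cw; apply: C_Omega_bar_iter_dx; apply: C_Omega_bar_iter_dy.
by rewrite addn0 addnC.
Qed.

(** The derivative extends continuously to the compact square. *)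
Lemma norm_dxy_fin_num l m w D : C_Omega_bar (l + m) w ->
  norm_Linfty D (dxy l m w) \is a fin_num.
Proof.
move=> /C_Omega_bar_dxy /C_Omega_bar_bounded [B HB].
rewrite ge0_fin_numE ?Lnorm_ge0 //.
have h p : `|dxy l m w p| <= `|B|.
  rewrite /dxy patchE; case: ifPn => [|_]; last by rewrite normr0.
  by rewrite inE => /HB /le_trans; apply; exact: ler_norm.
by apply: le_lt_trans (norm_Linfty_le _ _ h) _; rewrite ?ltey.
Qed.

Lemma le_norm_dxy l m w D U p : C_Omega_bar (l + m) w -> open U -> U `<=` D ->
  U `<=` Omega -> U p ->
  `|iter l dx (iter m dy w) p| <= fine (norm_Linfty D (dxy l m w)).
Proof.
move=> Cw oU UD UO Up; rewrite -lee_fin fineK ?norm_dxy_fin_num //.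
have E q : Omega q -> dxy l m w q = iter l dx (iter m dy w) q.
  by move=> Oq; rewrite /dxy patchE ifT // inE.
rewrite -E; last exact: UO.
apply: (@norm_Linfty_ge _ D U) => // q Uq.
apply: (@continuous_eq_on _ Omega _ (iter l dx (iter m dy w))) => //.
- exact: open_Omega.
- exact: UO.
- exact: (C_Omega_bar_continuous (C_Omega_bar_dxy Cw) (UO _ Uq)).
Qed.

Lemma sum_degree2 (h k : R) (n : nat -> nat -> \bar R) :
  (forall l m, (l + m = 2)%N -> n l m \is a fin_num) ->
  (\sum_(l < 3) \sum_(m < 3 | (l + m == 2)%N) (h ^+ l * k ^+ m)%:E * n l m)%E =
  (h ^+ 2 * fine (n 2 0) + h * k * fine (n 1 1) + k ^+ 2 * fine (n 0 2))%:E.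
Proof.
move=> nfin.
have E l m : (l + m = 2)%N -> ((h ^+ l * k ^+ m)%:E * n l m)%E
  = (h ^+ l * k ^+ m * fine (n l m))%:E.
  by move=> lm; rewrite [in RHS]EFinM fineK // nfin.
under eq_bigr do rewrite big_mkcond.
rewrite !big_ord_recl !big_ord0 /= !adde0 !add0e !E // -!EFinD; congr EFin.
by rewrite /bump /=; ring.
Qed.

Lemma within_continuous_slice (A : set (R * R)) w (B : set R) (g : R -> R * R) :
  {within A, continuous w} -> continuous g -> (forall s, B s -> A (g s)) ->
  {within B, continuous (w \o g)}.
Proof.
move=> /subspace_continuousP cw cg BA; apply/subspace_continuousP => s Bs.
have := cw _ (BA _ Bs); rewrite /cvg_to /= => cw' U /cw' HU.
have := cg s _ HU; rewrite /= => H.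
by apply: (@filterS _ (nbhs s) _ _ _ _ H) => t /= Ht Bt; apply: Ht; exact: BA.
Qed.

Lemma continuous_pairl (d : R) : continuous (fun s : R => (s, d)).
Proof.
move=> s U [[A B] /= [nA nB] AB].
apply: (@filterS _ (nbhs s) _ A) => // t At; apply: AB; split => //=.
exact: (nbhs_singleton nB).
Qed.

Lemma continuous_pairr (d : R) : continuous (fun s : R => (d, s)).
Proof.
move=> s U [[A B] /= [nA nB] AB].
apply: (@filterS _ (nbhs s) _ B) => // t Bt; apply: AB; split => //=.
exact: (nbhs_singleton nA).
Qed.

Lemma area_Omega_lty : (@area R Omega < +oo)%E.
Proof.
have side : (lebesgue_measure (`]0%R, 1%R[%classic : set R) < +oo)%E.
  by rewrite lebesgue_measure_itv /= lte_fin ltr01 sube0 ltey.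
rewrite /area product_measure1E; [|exact: measurable_itv..].
apply: lte_mul_pinfty; [exact: measure_ge0| |exact: side].
by rewrite ge0_fin_numE; [exact: side|exact: measure_ge0].
Qed.

End Norms.

(** * Two triangles glued along an edge *)

Section GluedTriangles.
Context {R : realType}.
Local Notation plane := (measurableTypeR R * measurableTypeR R)%type.
Context (x y : nat -> R) (N : nat).
Context (mx : unit_mesh x N) (my : unit_mesh y N).

(** The derivative of an affine function along [v] is read off from two points
    of [K] in that direction. *)
Lemma edge_slope (K : set (R * R)) (f : R * R -> R) (a b c d : R)
    (v p q : R * R) :
  d != 0 -> (forall p, K p -> f p = a + b * p.1 + c * p.2) -> K p -> K q ->
  q.1 - p.1 = d * v.1 -> q.2 - p.2 = d * v.2 ->
  b * v.1 + c * v.2 = (f q - f p) / d.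
Proof.
move=> d0 Kf Kp Kq E1 E2; rewrite !Kf //.
have -> : a + b * q.1 + c * q.2 - (a + b * p.1 + c * p.2)
  = b * (q.1 - p.1) + c * (q.2 - p.2) by ring.
by rewrite E1 E2; field.
Qed.

(** [K] and [K'] are the two triangles, [O] and [O'] open subsets of full
    measure, [p] and [q] the ends of the common edge, which has direction
    [v]. *)
Lemma glued_cell_bound (w wI vN : R * R -> R) (K K' O O' P : set (R * R))
    (v c p q : R * R) (d B M : R) :
  triangulation x y N K -> triangulation x y N K' ->
  measurable (K : set plane) -> measurable (K' : set plane) ->
  open O -> open O' -> O `<=` K -> O' `<=` K' ->
  area.-negligible (K `\` O) -> area.-negligible (K' `\` O') ->
  open P -> O `|` O' `<=` P -> P `<=` K `|` K' ->
  (forall z, P z -> P (point_refl c z)) ->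
  d != 0 -> K p -> K q -> K' p -> K' q ->
  q.1 - p.1 = d * v.1 -> q.2 - p.2 = d * v.2 ->
  pw_linear x y N wI -> pw_linear x y N vN -> wI p = w p -> wI q = w q ->
  (forall z, Omega z -> derivable w z v /\ {for z, continuous ('D_v w)}) ->
  (forall z, Omega z -> `|'D_v w z| <= B) -> 0 <= M ->
  (forall z, P z ->
    `|'D_v w z + 'D_v w (point_refl c z) - 2 * ((w q - w p) / d)| <= 2 * M) ->
  (`| \int[area]_(z in K `|` K')
        (elt_D x y N v (w \- wI) z * elt_D x y N v vN z)%:E |
    <= M%:E * norm_L1 (K `|` K') (elt_D x y N v vN))%E.
Proof.
move=> TK TK' mK mK' oO oO' OK OK' nK nK' oP OP PK symP d0 Kp Kq K'p K'q E1 E2.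
move=> Lw Lv wIp wIq Hw HB M0 HM.
have mP := open_plane_measurable _ oP.
have mO := open_plane_measurable _ oO; have mO' := open_plane_measurable _ oO'.
have POm : P `<=` Omega.
  apply: subset_trans interior_Omega_bar.
  move=> z Pz; apply: (@filterS _ (nbhs z) _ P); last exact: open_nbhs_nbhs.
  move=> z' /PK [] ; [exact: (triangulation_sub_Omega_bar mx my TK)|exact:
    (triangulation_sub_Omega_bar mx my TK')].
have Pfin : (@area R P < +oo)%E.
  apply: le_lt_trans area_Omega_lty; apply: le_measure; rewrite ?inE //.
  by apply: open_plane_measurable; exact: open_Omega.
have mQ : measurable (K `|` K' : set plane) by exact: measurableU.
have mG : measurable (O `|` O' : set plane) by exact: measurableU.
rewrite norm_L1E.
apply: (@cell_integral_bound _ c (K `|` K') P (O `|` O') ('D_v w) _ _ B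
   ((w q - w p) / d) ((vN q - vN p) / d) M) => //.
- apply: measure_negligible; first exact: measurableD.
  apply: negligibleS (negligibleU nK nK').
  by move=> z [[Kz|Kz] /not_orP [nO nO']]; [left|right].
- apply: open_continuous_plane_measurable => // z Pz.
  by have [] := Hw z (POm z Pz).
- by move=> z Pz; exact: HB (POm z Pz).
- apply: measurable_funTS; exact: elt_D_error_measurable.
- apply: measurable_funTS; exact: elt_D_pw_linear_measurable.
- have on_triangle T Q z : triangulation x y N T -> open Q -> Q `<=` T ->
  T p -> T q -> Q z ->
     elt_D x y N v (w \- wI) z = 'D_v w z - (w q - w p) / d
     /\ elt_D x y N v vN z = (vN q - vN p) / d.
    move=> TT oQ QT Tp Tq Qz.
    have Tz : T° z by apply: (@filterS _ (nbhs z) _ Q) => //;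
      exact: open_nbhs_nbhs.
    have Oz := triangulation_interior mx my TT Tz.
    have [a1 [b1 [c1 H1]]] := Lw.2 T TT; have [a2 [b2 [c2 H2]]] := Lv.2 T TT.
    split.
      rewrite (elt_D_error TT H1) //; last by have [] := Hw z Oz.
      by rewrite (edge_slope d0 H1 Tp Tq E1 E2) wIp wIq.
    by rewrite (elt_D_pw_linear v TT H2) // (edge_slope d0 H2 Tp Tq E1 E2).
  by move=> z [Oz|Oz]; [exact: on_triangle TK oO OK Kp Kq Oz|
    exact: on_triangle TK' oO' OK' K'p K'q Oz].
Qed.

End GluedTriangles.

(** * The cells of the triangulation *)

Section Cells.
Context {R : realType}.
Context (x y : nat -> R) (N : nat).
Context (mx : unit_mesh x N) (my : unit_mesh y N).

Lemma K1_rtri i j : (i < N)%N -> (j < N)%N ->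
  K1 x y i j = [set p | rtri (x i) (y j) (step x i) (step y j) p.1 p.2].
Proof.
move=> iN jN; have [_ _ hx] := mx; have [_ _ hy] := my.
rewrite -triangle_K1 ?gt_eqF ?hx ?hy // /K1.
by rewrite /step [x i + _]addrC [y j + _]addrC !subrK.
Qed.

Lemma K2_rtri i j : (i < N)%N -> (j < N)%N ->
  K2 x y i j =
  [set p | rtri (x i.+1) (y j.+1) (- step x i) (- step y j) p.1 p.2].
Proof.
move=> iN jN; have [_ _ hx] := mx; have [_ _ hy] := my.
rewrite -triangle_K2 ?gt_eqF ?hx ?hy // /K2.
by rewrite /step !subKr.
Qed.

Lemma Qset_estimate w wI vN i j :
  is_C3 w -> nodal_interpolant x y N w wI -> pw_linear x y N vN ->
  (i < N)%N -> (0 < j < N)%N -> step y j.-1 = step y j ->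
  (`| \int[area]_(p in Qset x y i j)
        (elt_dx x y N (w \- wI) p * elt_dx x y N vN p)%:E |
   <= (\sum_(l < 3) \sum_(m < 3 | (l + m == 2)%N)
           (step x i ^+ l * step y j ^+ m)%:E
           * norm_Linfty (Qset x y i j) (dxy l.+1 m w))
      * norm_L1 (Qset x y i j) (elt_dx x y N vN))%E.
Proof.
move=> [cw Cw] [LwI wIw] LvN iN /andP[j0 jN] Ek.
have jN' : (j.-1 < N)%N by rewrite (leq_ltn_trans (leq_pred j)).
have [_ _ hx] := mx; have [_ _ hy] := my.
set h := step x i; set k := step y j.
have h0 : 0 < h := hx i iN; have k0 : 0 < k := hy j jN.
have hn : h != 0 by rewrite gt_eqF.
have kn : k != 0 by rewrite gt_eqF.
have xS : x i.+1 = x i + h by rewrite /h /step; ring.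
have K1E := K1_rtri iN jN; have K2E := K2_rtri iN jN'.
rewrite prednK // Ek -/h -/k xS in K2E.
rewrite -/h -/k in K1E.
pose Q := Qset x y i j; rewrite -/Q.
pose P := [set p : R * R | para (x i + h / 2) (y j) h k p.1 p.2].
pose O := [set p : R * R | ortri (x i) (y j) h k p.1 p.2].
pose O' := [set p : R * R | ortri (x i + h) (y j) (- h) (- k) p.1 p.2].
have oP : open P by exact: para_open.
have PQ : P `<=` Q.
  by move=> p /(para_rtri h0 k0) [] H; [left; rewrite K2E|right; rewrite K1E].
have TK1 : triangulation x y N (K1 x y i j) by exists i, j; split => //; left.
have TK2 : triangulation x y N (K2 x y i j.-1) by exists i, j.-1; split => //;
  right.
have PO : P `<=` Omega.
  apply: subset_trans interior_Omega_bar => p Pp.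
  apply: (@filterS _ (nbhs p) _ P); last exact: open_nbhs_nbhs.
  by move=> z /PQ [] ; [exact: triangulation_sub_Omega_bar TK2 _|
    exact: triangulation_sub_Omega_bar TK1 _].
have Cx := C_Omega_bar_dx Cw; have Cy := C_Omega_bar_dy Cw.
have Cxx := C_Omega_bar_dx Cx; have Cyx := C_Omega_bar_dy Cx.
pose n l m := norm_Linfty Q (dxy l.+1 m w).
have nfin l m : (l + m = 2)%N -> n l m \is a fin_num.
  by move=> lm; apply: norm_dxy_fin_num; rewrite addSn lm.
have n0 l m : 0 <= fine (n l m) by rewrite fine_ge0 // Lnorm_ge0.
rewrite (sum_degree2 h k nfin).
have [B HB] := C_Omega_bar_bounded Cx.
apply: (@glued_cell_bound _ x y N mx my w wI vN (K2 x y i j.-1)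
  (K1 x y i j) O' O P
  ((1, 0) : R * R) (x i + h / 2, y j) (x i, y j) (x i.+1, y j) h B) => //.
- by rewrite K2E; exact: rtri_measurable.
- by rewrite K1E; exact: rtri_measurable.
- exact: ortri_open.
- exact: ortri_open.
- by rewrite K2E => p; exact: ortriW.
- by rewrite K1E => p; exact: ortriW.
- by rewrite K2E; apply: rtri_boundary_null; rewrite oppr_eq0.
- by rewrite K1E; exact: rtri_boundary_null.
- by move=> p; exact: ortri_para.
- by move=> p; exact: para_sym.
- by rewrite K2E /=; have := @rtri_leg _ (x i + h) (y j) (- h) (- k);
  rewrite addrK; apply; rewrite oppr_eq0.
- by rewrite K2E /= xS; exact: rtri_corner.
- by rewrite K1E /=; exact: rtri_corner.
- by rewrite K1E /= xS; exact: rtri_leg.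
- by rewrite /= xS; ring.
- by rewrite /=; ring.
- by apply: wIw; exact: ltnW.
- by apply: wIw => //; exact: ltnW.
- move=> z Oz; split; first by have [] := C_Omega_bar_derivable Cw Oz.
  exact: (C_Omega_bar_continuous Cx Oz).
- by rewrite !addr_ge0 // !mulr_ge0 // ?exprn_ge0 // ltW.
- have ch : x i + h / 2 + h / 2 = x i.+1 by rewrite xS; field.
  have chN : x i + h / 2 - h / 2 = x i by ring.
  have POm s t : para (x i + h / 2) (y j) h k s t -> Omega (s, t) by move=> ?;
    apply: PO.
  (* the estimate differentiates dx w in y, while dxy applies dx last *)
  have swapx p : Omega p -> dy (dx w) p = dx (dy w) p.
    by move=> Op; exact: (esym (dx_dyC (C_Omega_bar_mono Cw) Op)).
  have cont : {within `[x i + h / 2 - h / 2, x i + h / 2 + h / 2], continuous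
    (fun s => w (s, y j))}.
    apply: (within_continuous_slice (g := fun s => (s, y j)) cw).
      exact: continuous_pairl.
    have [/andP[xi0 _] /andP[_ xi1]] := (unit_mesh_range mx (ltnW iN),
      unit_mesh_range mx iN).
    have yj := unit_mesh_range my (ltnW jN).
    move=> s; rewrite ch chN /= in_itv /= => /andP[s0 s1]; split;
      rewrite /= in_itv //=.
    by rewrite (le_trans xi0 s0) (le_trans s1 xi1).
  have der1 s : `|s - (x i + h / 2)| < h / 2 ->
    is_derive s 1 (fun s => w (s, y j)) (dx w (s, y j)).
    by move=> sc; apply: (C_Omega_bar_is_derive_dx Cw); apply: POm;
      exact: para_mid.
  move=> [s t] Pst.
  have := @central_average R (fun s t => w (s, t)) (fun s t => dx w (s, t))
    (fun s t => dx (dx w) (s, t)) (fun s t => dy (dx w) (s, t))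
    (fun s t => dx (dx (dx w)) (s, t)) (fun s t => dx (dy (dx w)) (s, t))
    (fun s t => dy (dy (dx w)) (s, t)) (x i + h / 2) (y j) h k
    (fine (n 2 0)) (fine (n 1 1)) (fine (n 0 2)) h0 k0 cont der1 _ _ s t Pst.
  rewrite ch chN; apply.
    move=> s' t' /POm Oz; split.
    + exact: (C_Omega_bar_is_derive_dx Cx Oz).
    + exact: (C_Omega_bar_is_derive_dy Cx Oz).
    + exact: (C_Omega_bar_is_derive_dx Cxx Oz).
    + exact: (C_Omega_bar_is_derive_dx Cyx Oz).
    + exact: (C_Omega_bar_is_derive_dy Cyx Oz).
  move=> s' t' Pz; have Oz := POm _ _ Pz; split.
  + exact: (@le_norm_dxy _ 3 0 w Q P (s', t') Cw oP PQ PO Pz).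
  + rewrite (dx_eq_on open_Omega swapx Oz).
    exact: (@le_norm_dxy _ 2 1 w Q P (s', t') Cw oP PQ PO Pz).
  + rewrite (dy_eq_on open_Omega swapx Oz) -(dx_dyC Cy Oz).
    exact: (@le_norm_dxy _ 1 2 w Q P (s', t') Cw oP PQ PO Pz).
Qed.

(** The parallelogram and the partial derivatives are those of [Qset_estimate]
    with the coordinates exchanged, so the two steps of the mesh change places
    in [para] and in [central_average]. *)
Lemma Sset_estimate w wI vN i j :
  is_C3 w -> nodal_interpolant x y N w wI -> pw_linear x y N vN ->
  (0 < i < N)%N -> (j < N)%N -> step x i.-1 = step x i ->
  (`| \int[area]_(p in Sset x y i j)
        (elt_dy x y N (w \- wI) p * elt_dy x y N vN p)%:E |
   <= (\sum_(l < 3) \sum_(m < 3 | (l + m == 2)%N)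
           (step x i ^+ l * step y j ^+ m)%:E
           * norm_Linfty (Sset x y i j) (dxy l m.+1 w))
      * norm_L1 (Sset x y i j) (elt_dy x y N vN))%E.
Proof.
move=> [cw Cw] [LwI wIw] LvN /andP[i0 iN] jN Eh.
have iN' : (i.-1 < N)%N by rewrite (leq_ltn_trans (leq_pred i)).
have [_ _ hx] := mx; have [_ _ hy] := my.
set h := step x i; set k := step y j.
have h0 : 0 < h := hx i iN; have k0 : 0 < k := hy j jN.
have hn : h != 0 by rewrite gt_eqF.
have kn : k != 0 by rewrite gt_eqF.
have yS : y j.+1 = y j + k by rewrite /k /step; ring.
have K1E := K1_rtri iN jN; have K2E := K2_rtri iN' jN.
rewrite prednK // Eh -/h -/k yS in K2E.
rewrite -/h -/k in K1E.
pose Q := Sset x y i j; rewrite -/Q.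
pose P := [set p : R * R | para (y j + k / 2) (x i) k h p.2 p.1].
pose O := [set p : R * R | ortri (x i) (y j) h k p.1 p.2].
pose O' := [set p : R * R | ortri (x i) (y j + k) (- h) (- k) p.1 p.2].
have oP : open P by exact: (open_swap (@para_open _ (y j) (x i) _ _ k0 h0)).
have PQ : P `<=` Q.
  by move=> p /(para_rtri k0 h0) [] /rtri_swap H; [left; rewrite K2E|right;
    rewrite K1E].
have TK1 : triangulation x y N (K1 x y i j) by exists i, j; split => //; left.
have TK2 : triangulation x y N (K2 x y i.-1 j) by exists i.-1, j; split => //;
  right.
have PO : P `<=` Omega.
  apply: subset_trans interior_Omega_bar => p Pp.
  apply: (@filterS _ (nbhs p) _ P); last exact: open_nbhs_nbhs.
  by move=> z /PQ [] ; [exact: triangulation_sub_Omega_bar TK2 _|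
    exact: triangulation_sub_Omega_bar TK1 _].
have Cy := C_Omega_bar_dy Cw.
have Cxy := C_Omega_bar_dx Cy; have Cyy := C_Omega_bar_dy Cy.
pose n l m := norm_Linfty Q (dxy l m.+1 w).
have nfin l m : (l + m = 2)%N -> n l m \is a fin_num.
  by move=> lm; apply: norm_dxy_fin_num; rewrite addnS lm.
have n0 l m : 0 <= fine (n l m) by rewrite fine_ge0 // Lnorm_ge0.
rewrite (sum_degree2 h k nfin).
have [B HB] := C_Omega_bar_bounded Cy.
apply: (@glued_cell_bound _ x y N mx my w wI vN (K2 x y i.-1 j)
  (K1 x y i j) O' O P
  ((0, 1) : R * R) (x i, y j + k / 2) (x i, y j) (x i, y j.+1) k B) => //.
- by rewrite K2E; exact: rtri_measurable.
- by rewrite K1E; exact: rtri_measurable.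
- exact: ortri_open.
- exact: ortri_open.
- by rewrite K2E => p; exact: ortriW.
- by rewrite K1E => p; exact: ortriW.
- by rewrite K2E; apply: rtri_boundary_null; rewrite oppr_eq0.
- by rewrite K1E; exact: rtri_boundary_null.
- by move=> p [] /ortri_swap H; apply: ortri_para => //; [left|right].
- by move=> p; exact: para_sym.
- rewrite K2E /=; apply: rtri_swap.
  by have := @rtri_leg _ (y j + k) (x i) (- k) (- h); rewrite addrK; apply;
    rewrite oppr_eq0.
- by rewrite K2E /= yS; exact: rtri_corner.
- by rewrite K1E /=; exact: rtri_corner.
- by rewrite K1E /= yS; apply: rtri_swap; exact: rtri_leg.
- by rewrite /=; ring.
- by rewrite /= yS; ring.
- by apply: wIw; exact: ltnW.
- by apply: wIw => //; exact: ltnW.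
- move=> z Oz; split; first by have [] := C_Omega_bar_derivable Cw Oz.
  exact: (C_Omega_bar_continuous Cy Oz).
- by rewrite !addr_ge0 // !mulr_ge0 // ?exprn_ge0 // ltW.
- have ck : y j + k / 2 + k / 2 = y j.+1 by rewrite yS; field.
  have ckN : y j + k / 2 - k / 2 = y j by ring.
  have POm s t : para (y j + k / 2) (x i) k h s t -> Omega (t, s).
    by move=> Pst; apply: PO.
  have cont : {within `[y j + k / 2 - k / 2, y j + k / 2 + k / 2], continuous
    (fun s => w (x i, s))}.
    apply: (within_continuous_slice (g := fun s => (x i, s)) cw).
      exact: continuous_pairr.
    have [/andP[yj0 _] /andP[_ yj1]] := (unit_mesh_range my (ltnW jN),
      unit_mesh_range my jN).
    have xi := unit_mesh_range mx (ltnW iN).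
    move=> s; rewrite ck ckN /= in_itv /= => /andP[s0 s1]; split;
      rewrite /= in_itv //=.
    by rewrite (le_trans yj0 s0) (le_trans s1 yj1).
  have der1 s : `|s - (y j + k / 2)| < k / 2 ->
    is_derive s 1 (fun s => w (x i, s)) (dy w (x i, s)).
    by move=> sc; apply: (C_Omega_bar_is_derive_dy Cw); apply: POm;
      exact: para_mid.
  move=> [s t] Pst.
  have rev (a b c : R) : h ^+ 2 * a + h * k * b + k ^+ 2 * c
    = k ^+ 2 * c + k * h * b + h ^+ 2 * a by clear; ring.
  rewrite rev.
  have := @central_average R (fun s t => w (t, s)) (fun s t => dy w (t, s))
    (fun s t => dy (dy w) (t, s)) (fun s t => dx (dy w) (t, s))
    (fun s t => dy (dy (dy w)) (t, s)) (fun s t => dy (dx (dy w)) (t, s))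
    (fun s t => dx (dx (dy w)) (t, s)) (y j + k / 2) (x i) k h
    (fine (n 0 2)) (fine (n 1 1)) (fine (n 2 0)) k0 h0 cont der1 _ _ t s Pst.
  rewrite ck ckN; apply.
    move=> s' t' /POm Oz; split.
    + exact: (C_Omega_bar_is_derive_dy Cy Oz).
    + exact: (C_Omega_bar_is_derive_dx Cy Oz).
    + exact: (C_Omega_bar_is_derive_dy Cyy Oz).
    + exact: (C_Omega_bar_is_derive_dy Cxy Oz).
    + exact: (C_Omega_bar_is_derive_dx Cxy Oz).
  move=> s' t' Pz; have Oz := POm _ _ Pz; split.
  + exact: (@le_norm_dxy _ 0 3 w Q P (t', s') Cw oP PQ PO Pz).
  + rewrite -(dx_dyC Cy Oz).
    exact: (@le_norm_dxy _ 1 2 w Q P (t', s') Cw oP PQ PO Pz).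
  + exact: (@le_norm_dxy _ 2 1 w Q P (t', s') Cw oP PQ PO Pz).
Qed.

End Cells.

Lemma layer_width_gt0 (R : realType) (eps beta : R) N : (1 < N)%N ->
  0 < eps -> 0 < beta -> 0 < layer_width eps beta N.
Proof.
move=> N1 e0 b0; rewrite /layer_width !mulr_gt0 ?invr_gt0 //.
by rewrite ln_gt0 // ltr1n.
Qed.

Unset Implicit Arguments.
Set Strict Implicit.

Theorem lemma2p1 (R : realType) (beta1 beta2 : R)
    (beta1_gt0 : 0 < beta1) (beta2_gt0 : 0 < beta2) :
  exists2 C : R, 0 < C &
  forall (eps : R) (N : nat) (w wI vN : R * R -> R),
  let lambdax := layer_width eps beta1 N in
  let lambday := layer_width eps beta2 N in
  let x := shishkin lambdax N in
  let y := shishkin lambday N in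
  (4 <= N)%N -> ~~ odd N ->
  0 < eps -> eps <= N%:R^-1 ->
  lambdax <= 1 / 2 -> lambday <= 1 / 2 ->
  is_C3 w -> nodal_interpolant x y N w wI -> VN x y N vN ->
  (forall i j : nat, (i <= N.-1)%N -> (1 <= j <= N.-1)%N ->
     step y j.-1 = step y j ->
     (`| \int[area]_(p in Qset x y i j)
           (elt_dx x y N (w \- wI) p * elt_dx x y N vN p)%:E |
      <= C%:E
         * (\sum_(l < 3) \sum_(m < 3 | (l + m == 2)%N)
              (step x i ^+ l * step y j ^+ m)%:E
              * norm_Linfty (Qset x y i j) (dxy l.+1 m w))
         * norm_L1 (Qset x y i j) (elt_dx x y N vN))%E)
  /\
  (forall i j : nat, (1 <= i <= N.-1)%N -> (j <= N.-1)%N ->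
     step x i.-1 = step x i ->
     (`| \int[area]_(p in Sset x y i j)
           (elt_dy x y N (w \- wI) p * elt_dy x y N vN p)%:E |
      <= C%:E
         * (\sum_(l < 3) \sum_(m < 3 | (l + m == 2)%N)
              (step x i ^+ l * step y j ^+ m)%:E
              * norm_Linfty (Sset x y i j) (dxy l m.+1 w))
         * norm_L1 (Sset x y i j) (elt_dy x y N vN))%E).
Proof.
exists 1 => // eps N w wI vN lambdax lambday x y N4 evenN eps0 _ lx ly.
move=> Cw HwI [LvN _].
have N1 : (1 < N)%N by rewrite (leq_trans _ N4).
have mx : unit_mesh x N.
  by apply: shishkin_unit_mesh => //; exact: layer_width_gt0.
have my : unit_mesh y N.
  by apply: shishkin_unit_mesh => //; exact: layer_width_gt0.
have NE i : (i <= N.-1)%N = (i < N)%N by rewrite -ltnS prednK // ltnW.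
split=> i j.
  rewrite !NE mul1e => iN jN; exact: Qset_estimate.
rewrite !NE mul1e => iN jN; exact: Sset_estimate.
Qed.
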